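(* Suppose single sample splitting is performed, and let $\hat\psi^{\mathrm{NR}}_k$ be the single sample split Newey and Robins plug-in estimator of $\psi(\mathbb P)=\mathbb E_{\mathbb P}[\mathrm{Cov}_{\mathbb P}(A,Y\mid X)]$ defined in the context. Then $$\sup_{\mathbb P\in\mathcal P_{(\alpha,\beta)}}\left|\mathbb E_{\mathbb P}\left(\hat\psi^{\mathrm{NR}}_{k}-\psi(\mathbb P)\right)\right|\asymp k^{-(\alpha+\beta)/d},\qquad \sup_{\mathbb P\in\mathcal P_{(\alpha,\beta)}}\mathrm{Var}_{\mathbb P}(\hat\psi^{\mathrm{NR}}_{k})\lesssim\frac1n+\frac{k}{n^2}.$$
   Context: Notation. $a\vee b=\max(a,b)$; integrals are over $[0,1]^d$. For nonnegative sequences, $a_n\lesssim b_n$ means there is a constant $C>0$ with $a_n\le Cb_n$ for all $n\ge n_0$; $a_n\gtrsim b_n$ means $b_n\lesssim a_n$; $a_n\asymp b_n$ means both. The resolution $k$ may depend on $n$; implicit constants do not depend on $n$ or $k$. Wavelets. Fix a compactly supported Cohen–Daubechies–Vial type orthonormal wavelet basis $\{\Phi_{J_0m},\Psi^{\iota}_{lm'}: m\in\mathcal Z_{J_0},\,m'\in\mathcal Z_l,\,\iota\in\{0,1\}^d\setminus\{0\},\,l\ge J_0\}$ of $L^2([0,1]^d)$ of regularity $S\ge1$, $S>\alpha\vee\beta$, with $2^{J_0}\ge S$, $|\mathcal Z_l|\asymp 2^{ld}$. For $j\ge J_0$ let $V_j=\mathrm{span}\{\Phi_{jm}:m\in\mathcal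 Z_j\}$ ($\{\Phi_{jm}\}_m$ the orthonormal scaling functions at level $j$; the $V_j$ are nested). A resolution is a number $k=2^{jd}$, $j\ge J_0$; write $V_k,\Phi_{km},\mathcal Z_k$ for $V_j,\Phi_{jm},\mathcal Z_j$. Standard properties: $|\Phi_{km}|\lesssim\sqrt k$ uniformly with support in a set of Lebesgue measure $O(1/k)$; $V_k$ contains all polynomials of degree at most $S-1$. The projection kernel is $K_{V_k}(x,y)=\sum_{m\in\mathcal Z_k}\Phi_{km}(x)\Phi_{km}(y)$. Hölder ball. $H(\alpha,M)$ is the set of uniformly continuous $h:[0,1]^d\to\mathbb R$ with $2^{J_0(\alpha+d/2)}\max_m|\langle h,\Phi_{J_0m}\rangle|+\sup_{l\ge J_0,m\in\mathcal Z_l,\iota}2^{l(\alpha+d/2)}|\langle h,\Psi^\iota_{lm}\rangle|\le M$. Model. $\mathcal P_{(\alpha,\beta)}$ is the set of distributions $\mathbb P$ of $(X,A,Y)\in[0,1]^d\times\mathbb R\times\mathbb R$ with $X\sim\mathrm{Uniform}([0,1]^d)$, $A,Y\in[C_1,C_2]$ a.s., $p(x):=\mathbb E_{\mathbb P}[A\mid X=x]\in H(\alpha,M)$ and $b(x):=\mathbb E_{\mathbb P}[Y\mid X=x]\in H(\beta,M)$, where $C_1,C_2\in\mathbb R$, $\alpha,\beta,M>0$ are fixed known constants. The functional is $\psi(\mathbb P)=\mathbb E_{\mathbb P}[\mathrm{Cov}_{\mathbb P}(A,Y\mid X)]$. Estimator. I.i.d. observations from $\mathbb P$ are split into two disjoint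 subsamples $\mathcal D_1,\mathcal D_2$, each of size $n$. Put $\hat b^{(1)}_k(x)=\frac1n\sum_{i\in\mathcal D_1}Y_iK_{V_k}(X_i,x)$ and $\hat\psi^{\mathrm{NR}}_k=\frac1n\sum_{i\in\mathcal D_2}A_i(Y_i-\hat b^{(1)}_k(X_i))$.
   Formalization: The lower half of the bias equivalence is proved assuming C_1 < C_2 and that the model with some radius M' < M in place of M is nonempty; without such a condition it fails, e.g. for C_1 = C_2 = 0, where A = Y = 0 and the bias is zero. *)

(* Defs.v *)
From HB Require Import structures.
From mathcomp Require Import all_boot all_order all_algebra.
From mathcomp Require Import all_classical all_reals all_analysis.

Set Implicit Arguments.
Unset Strict Implicit.
Unset Printing Implicit Defensive.

Import Order.TTheory GRing.Theory Num.Theory.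
Import numFieldNormedType.Exports.

Local Open Scope classical_set_scope.
Local Open Scope ring_scope.

Definition cons_pair (disp : measure_display) (T : measurableType disp) n
  (z : T * n.-tuple T) : n.+1.-tuple T := [the n.+1.-tuple T of z.1 :: z.2].

Lemma measurable_cons_pair disp (T : measurableType disp) n :
  measurable_fun [set: T * n.-tuple T] (@cons_pair disp T n).
Proof. exact: (measurable_cons measurable_fst measurable_snd). Qed.

HB.instance Definition _ disp (T : measurableType disp) n :=
  @isMeasurableFun.Build _ _ _ _ (@cons_pair disp T n)
    (@measurable_cons_pair disp T n).

(* The n-fold product P (x) ... (x) P on n-tuples. *)
Fixpoint power_prob (disp : measure_display) (T : measurableType disp)
    (R : realType) (P : probability T R) (n : nat) :
    probability (n.-tuple T) R :=
  match n with
  | 0 => \d_([tuple] : 0.-tuple T)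
  | n'.+1 => distribution (P \x power_prob P n')%E (@cons_pair disp T n')
  end.

(* The library has the Lebesgue measure on [measurableTypeR R], a copy of R; this
   moves the uniform distribution on [0,1] to R. *)
Definition toR (R : realType) (x : measurableTypeR R) : R := x.

Lemma measurable_toR (R : realType) :
  measurable_fun [set: measurableTypeR R] (@toR R).
Proof. exact: measurable_id. Qed.

HB.instance Definition _ (R : realType) :=
  @isMeasurableFun.Build _ _ _ _ (@toR R) (@measurable_toR R).

(* Points of [0,1]^d are d-tuples of reals.  [Ucube] is the Lebesgue measure of
   [0,1]^d, seen as a probability measure on R^d that is carried by the cube;
   integrals over [0,1]^d are integrals against it. *)
Definition Ucube (R : realType) (d : nat) : probability (d.-tuple R) R :=
  power_prob (distribution (uniform_prob (@ltr01 R)) (@toR R)) d.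

Definition cube (R : realType) (d : nat) : set (d.-tuple R) :=
  [set x | forall i : 'I_d, 0 <= tnth x i <= 1].

Definition inner (R : realType) (d : nat) (f g : d.-tuple R -> R) : R :=
  \int[Ucube R d]_x (f x * g x).

(* The family (e i), i in the index set A, is an orthonormal basis of
   L^2([0,1]^d): orthonormal, with dense linear span. *)
Definition orthonormal_basis (R : realType) (d : nat) (I : eqType) (A : set I)
    (e : I -> d.-tuple R -> R) : Prop :=
  [/\ forall i, A i -> e i \in Lfun (Ucube R d) 2%:E,
      forall i i', A i -> A i' -> inner (e i) (e i') = (i == i')%:R
    & forall f, f \in Lfun (Ucube R d) 2%:E -> forall eps : R, 0 < eps ->
        exists s : seq (R * I), (forall t, t \in s -> A t.2) /\
          (Lnorm (Ucube R d) 2%:E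
             (fun x => (f x - \sum_(t <- s) t.1 * e t.2 x)%R%:E) < eps%:E)%E].

Definition cube_span (R : realType) (d : nat) (I : finType)
    (e : I -> d.-tuple R -> R) : set (d.-tuple R -> R) :=
  [set f | exists c : I -> R,
     forall x, cube x -> f x = \sum_(i : I) c i * e i x].

(* The univariate functions a Cohen-Daubechies-Vial system on [0,1] is built
   from; the boolean is [false] for scaling functions, [true] for wavelets.
   [inner_piece] is the Daubechies scaling function or wavelet, [left_edge] and
   [right_edge] the boundary functions, [edges] of each kind at either end. *)
Record cdv_generators (R : realType) := CdvGenerators {
  edges : nat;
  inner_piece : bool -> R -> R;
  left_edge : bool -> nat -> R -> R;
  right_edge : bool -> nat -> R -> R }.

(* The m-th function of level l, for m < 2^l. *)
Definition wave1 (R : realType) (W : cdv_generators R) (w : bool) (l m : nat)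
    (x : R) : R :=
  let s : R := 2 ^+ l in
  Num.sqrt s *
  (if (m < edges W)%N then left_edge W w m (s * x)
   else if (2 ^ l - edges W <= m)%N
        then right_edge W w (2 ^ l - m).-1 (s * (1 - x))
   else inner_piece W w (s * x - m%:R)).

(* Regularity S >= 1: derivatives up to order S - 1, the last one Lipschitz
   (a compactly supported function of class C^S has this property). *)
Definition regular (R : realType) (S : nat) (f : R -> R) : Prop :=
  (forall i : nat, (i < S.-1)%N -> forall x : R, derivable (derive1n i f) x 1) /\
  (exists L : R, forall x y : R,
     `|derive1n S.-1 f x - derive1n S.-1 f y| <= L * `|x - y|).

Definition compactly_supported (R : realType) (f : R -> R) : Prop :=
  exists r : R, forall x, r < `|x| -> f x = 0.

Definition location (d l : nat) : finType := {ffun 'I_d -> 'I_(2 ^ l)}.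
Definition orientation (d : nat) : finType := {ffun 'I_d -> bool}.
Definition iota0 (d : nat) : orientation d := [ffun => false].

(* Tensor products: [wavelet W iota m] is Psi^iota_{lm} for iota <> 0, and
   Phi_{lm} for iota = 0. *)
Definition wavelet (R : realType) (W : cdv_generators R) (d l : nat)
    (iota : orientation d) (m : location d l) (x : d.-tuple R) : R :=
  \prod_(i < d) wave1 W (iota i) l (m i) (tnth x i).

Definition scaling (R : realType) (W : cdv_generators R) (d j : nat)
    (m : location d j) : d.-tuple R -> R :=
  wavelet W (iota0 d) m.

Definition resolution_space (R : realType) (W : cdv_generators R) (d j : nat) :
    set (d.-tuple R -> R) :=
  cube_span (fun m : location d j => scaling W m).
Arguments resolution_space {R} W d j _.

(* Index set of {Phi_{J0 m}, Psi^iota_{l m'} : l >= J0, iota <> 0}. *)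
Definition basis_index (d : nat) : eqType :=
  {l : nat & (orientation d * location d l)%type}.

Definition basis_range (d J0 : nat) : set (basis_index d) :=
  [set t | (J0 <= tag t)%N /\
           ((tagged t).1 <> iota0 d \/ tag t = J0)].

(* Since the generators are continuous, identities in L^2([0,1]^d) between
   finite linear combinations of the functions below hold at every point of the
   cube, which is how [cube_span] states them.  The edge functions only matter on
   [0, +oo[; there they are restrictions of finite combinations of translates of
   the interior ones, so they do have regular compactly supported extensions
   to R. *)
Record cdv_basis (R : realType) (W : cdv_generators R) (d S J0 : nat) : Prop :=
  CdvBasis {
  cdv_interior : forall w, compactly_supported (inner_piece W w) /\
    regular S (inner_piece W w);
  cdv_left : forall w m, (m < edges W)%N ->
    compactly_supported (left_edge W w m) /\ regular S (left_edge W w m);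
  cdv_right : forall w m, (m < edges W)%N ->
    compactly_supported (right_edge W w m) /\ regular S (right_edge W w m);
  cdv_orthonormal_basis : orthonormal_basis (@basis_range d J0)
    (fun t : basis_index d => wavelet W (tagged t).1 (tagged t).2);
  cdv_scaling_orthonormal : forall j, (J0 <= j)%N -> forall m m' : location d j,
    inner (scaling W m) (scaling W m') = (m == m')%:R;
  (* V_{j+1} is spanned by the Phi_{jm} and the Psi^iota_{jm} *)
  cdv_multiresolution : forall j, (J0 <= j)%N ->
    resolution_space W d j.+1 =
    cube_span (fun t : (orientation d * location d j)%type => wavelet W t.1 t.2);
  (* all monomials of total degree at most S - 1 belong to V_j *)
  cdv_polynomials : forall j, (J0 <= j)%N -> forall e : 'I_d -> nat,
    (\sum_(i < d) e i < S)%N ->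
    resolution_space W d j (fun x => \prod_(i < d) tnth x i ^+ e i) }.

Definition proj_kernel (R : realType) (W : cdv_generators R) (d j : nat)
    (x y : d.-tuple R) : R :=
  \sum_(m : location d j) scaling W m x * scaling W m y.

Definition hoelder_norm (R : realType) (W : cdv_generators R) (d J0 : nat)
    (gamma : R) (h : d.-tuple R -> R) : \bar R :=
  ((2 `^ (J0%:R * (gamma + d%:R / 2)) *
    \big[Num.max/0]_(m : location d J0) `|inner h (scaling W m)|)%:E +
   ereal_sup [set y | exists (l : nat) (iota : orientation d)
                             (m : location d l),
     [/\ (J0 <= l)%N, iota <> iota0 d &
         y = (2 `^ (l%:R * (gamma + d%:R / 2)) *
              `|inner h (wavelet W iota m)|)%:E]])%E.

Definition unif_continuous_on_cube (R : realType) (d : nat)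
    (h : d.-tuple R -> R) : Prop :=
  forall eps : R, 0 < eps -> exists2 delta : R, 0 < delta &
    forall x y : d.-tuple R, cube x -> cube y ->
      (forall i, `|tnth x i - tnth y i| < delta) -> `|h x - h y| < eps.

Definition hoelder_ball (R : realType) (W : cdv_generators R) (d J0 : nat)
    (gamma M : R) : set (d.-tuple R -> R) :=
  [set h | unif_continuous_on_cube h /\
           (hoelder_norm W J0 gamma h <= M%:E)%E].

(* An observation (X, A, Y). *)
Notation obs R d := ((d.-tuple R * R) * R)%type.

Definition obsX (R : realType) (d : nat) (o : obs R d) : d.-tuple R := o.1.1.
Definition obsA (R : realType) (d : nat) (o : obs R d) : R := o.1.2.
Definition obsY (R : realType) (d : nat) (o : obs R d) : R := o.2.

Definition uniform_design (R : realType) (d : nat)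
    (P : probability (obs R d) R) : Prop :=
  forall B : set (d.-tuple R), measurable B ->
    P (@obsX R d @^-1` B) = Ucube R d B.

(* [g] is a version of x |-> E_P[Z | X = x], for X uniform on the cube. *)
Definition is_cond_mean (R : realType) (d : nat) (P : probability (obs R d) R)
    (Z : obs R d -> R) (g : d.-tuple R -> R) : Prop :=
  (Ucube R d).-integrable setT (EFin \o g) /\
  forall B : set (d.-tuple R), measurable B ->
    \int[P]_(o in @obsX R d @^-1` B) Z o = \int[Ucube R d]_(x in B) g x.

Definition cond_mean (R : realType) (d : nat) (P : probability (obs R d) R)
    (Z : obs R d -> R) : d.-tuple R -> R :=
  xget (fun=> 0) [set g | is_cond_mean P Z g].

Definition cond_cov (R : realType) (d : nat) (P : probability (obs R d) R)
    (Z1 Z2 : obs R d -> R) : d.-tuple R -> R :=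
  cond_mean P (fun o => (Z1 o - cond_mean P Z1 (obsX o)) *
                        (Z2 o - cond_mean P Z2 (obsX o))).

Definition psi (R : realType) (d : nat) (P : probability (obs R d) R) : R :=
  \int[P]_o cond_cov P (@obsA R d) (@obsY R d) (obsX o).

Definition model (R : realType) (W : cdv_generators R) (d J0 : nat)
    (alpha beta M C1 C2 : R) : set (probability (obs R d) R) :=
  [set P | [/\ uniform_design P,
     {ae P, forall o, C1 <= obsA o <= C2 /\ C1 <= obsY o <= C2},
     exists2 p, is_cond_mean P (@obsA R d) p & hoelder_ball W J0 alpha M p &
     exists2 b, is_cond_mean P (@obsY R d) b & hoelder_ball W J0 beta M b]].
Arguments model {R} W d J0 alpha beta M C1 C2 _.

(* The range [C1, C2] is not a point, and is compatible with a radius smaller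
   than M.  This holds whenever C1 <= 0 <= C2, C1 < C2 and 0 < M.  It is needed
   for lower bounds: if, say, C1 > 0 and M is too small for C1, then the model
   is empty or, at the critical radius, possibly reduced to constant A. *)
Definition nondegenerate_model (R : realType) (W : cdv_generators R) (d J0 : nat)
    (alpha beta M C1 C2 : R) : Prop :=
  C1 < C2 /\
  exists2 M' : R, M' < M & model W d J0 alpha beta M' C1 C2 !=set0.
Arguments nondegenerate_model {R} W d J0 alpha beta M C1 C2.

Definition bhat (R : realType) (W : cdv_generators R) (d n j : nat)
    (D1 : n.-tuple (obs R d)) (x : d.-tuple R) : R :=
  n%:R^-1 * \sum_(i < n)
    obsY (tnth D1 i) * proj_kernel W j (obsX (tnth D1 i)) x.

Definition psihat (R : realType) (W : cdv_generators R) (d n j : nat)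
    (D : n.-tuple (obs R d) * n.-tuple (obs R d)) : R :=
  n%:R^-1 * \sum_(i < n)
    obsA (tnth D.2 i) *
    (obsY (tnth D.2 i) - bhat W j D.1 (obsX (tnth D.2 i))).

(* Law of the two subsamples. *)
Definition sample_law (R : realType) (d n : nat)
    (P : probability (obs R d) R) :
    probability (n.-tuple (obs R d) * n.-tuple (obs R d))%type R :=
  (power_prob P n \x power_prob P n)%E.

(* The bounds are indexed by the subsample size n and the level j >= J0 of the
   resolution k = 2^(jd); constants are uniform in both. *)
Definition resolution (d j : nat) : nat := (2 ^ (j * d))%N.

Definition lesssim (R : realType) (J0 : nat) (a b : nat -> nat -> \bar R) :
    Prop :=
  exists2 C : R, 0 < C & exists n0 : nat, forall n j : nat,
    (n0 <= n)%N -> (J0 <= j)%N -> (a n j <= C%:E * b n j)%E.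

(* Main.v *)
Require Import Defs.
From mathcomp Require Import finmap.
From mathcomp Require Import all_boot all_order all_algebra.
From mathcomp Require Import all_classical all_reals all_analysis.
From mathcomp Require Import measurable_realfun ring lra zify.

(** The kernel has finite rank, so the estimator is a bilinear statistic of the
    two subsamples: it is a finite sum of products F_r(D2) G_r(D1), where F_r and
    G_r are the averages of f_r and g_r, and (f_r, g_r) runs over (A Y, 1) and the
    pairs (- A Phi_m(X), Y Phi_m(X)) ([psihatE]).  Its first two moments follow
    from those of the pairs (f_r, g_r) under P.

    Bias.  By the tower property, psi is E[A Y] - <p, b>, and the mean of the
    estimator is E[A Y] minus the sum of the <p, Phi_m> <b, Phi_m>.  The bias is
    therefore <p, b> minus that sum, the [residual_form] of the scaling functions
    ([integral_psihat]).  The sum depends only on the resolution space, not on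
    the orthonormal basis, hence raising the level by one adds exactly the
    products of wavelet coefficients of one level ([proj_form_succ]); and the
    residual tends to 0, since the basis spans a dense space
    ([residual_form_cvg]).  So the bias is the sum over the levels l >= j of at
    most 2^d 2^(ld) products of wavelet coefficients, each of size at most
    M^2 2^(-l(alpha + beta + d)): a geometric series, of order
    2^(-j(alpha + beta)) = k^(-(alpha + beta)/d) ([residual_form_le]).

    Lower bound.  A member of the model with radius M' < M is shrunk slightly
    towards the constant (C1 + C2)/2, which has no wavelet coefficients; this
    leaves room, both in the range and in the Hoelder balls, for adding to p and
    to b plus or minus a multiple of the sum of all the wavelets of level j and
    of a fixed orientation, with coefficients of order 2^(-j(alpha + d/2)) and
    2^(-j(beta + d/2)) ([perturbation]).  That sum is bounded because only
    boundedly many wavelets overlap, and its residual with itself is 2^(jd).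
    The residual form is bilinear, so by [polarization] one of the four sign
    choices gives a bias of at least the product of the two sizes, again of order
    2^(-j(alpha + beta)).  The law with A = p(X) and Y = b(X) realizes it.

    Variance.  Expanding the second moment of the bilinear statistic leaves terms
    of order 1/n, which are second moments of A Y - A (Pi b)(X) and
    E[A Y] - Y (Pi p)(X), bounded by Bessel's inequality, and a term of order
    1/n^2, controlled by the integral of the squared kernel, which is k
    ([variance_bilinear_stat], [variance_psihat]). *)

Set Implicit Arguments.
Unset Strict Implicit.
Unset Printing Implicit Defensive.

Import Order.TTheory GRing.Theory Num.Theory.
Import numFieldNormedType.Exports.

Local Open Scope classical_set_scope.
Local Open Scope ring_scope.

(** * Essentially bounded functions *)

(** All the random variables at hand are products of observations, confined to
    [C1, C2] only almost surely, and of bounded wavelets.  Essentially bounded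
    functions contain them and form an algebra, on which the integral of a
    probability is a linear form without any side condition of integrability. *)
Definition ess_bounded (disp : measure_display) (T : measurableType disp)
    (R : realType) (P : probability T R) (f : T -> R) : Prop :=
  measurable_fun setT f /\ exists C : R, {ae P, forall x, `|f x| <= C}.

Section EssBounded.
Context (disp : measure_display) (T : measurableType disp) (R : realType).
Variable P : probability T R.
Implicit Types f g h : T -> R.
Local Notation bdd := (ess_bounded P).

Lemma bdd_cst (c : R) : bdd (fun=> c).
Proof. by split=> //; exists `|c|; apply: aeW. Qed.

Lemma bddD f g : bdd f -> bdd g -> bdd (fun x => f x + g x).
Proof.
move=> [mf [C Cf]] [mg [D Dg]]; split; first exact: measurable_funD.
exists (C + D); apply: filterS2 Cf Dg => x Cx Dx.
by rewrite (le_trans (ler_normD _ _))// lerD.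
Qed.

Lemma bddM f g : bdd f -> bdd g -> bdd (fun x => f x * g x).
Proof.
move=> [mf [C Cf]] [mg [D Dg]]; split; first exact: measurable_funM.
exists (C * D); apply: filterS2 Cf Dg => x Cx Dx.
by rewrite normrM ler_pM.
Qed.

Lemma bddZ (c : R) f : bdd f -> bdd (fun x => c * f x).
Proof. exact/bddM/bdd_cst. Qed.

Lemma bddN f : bdd f -> bdd (fun x => - f x).
Proof.
by move=> /(bddZ (-1)); under eq_fun do rewrite mulN1r.
Qed.

Lemma bddB f g : bdd f -> bdd g -> bdd (fun x => f x - g x).
Proof. by move=> bf bg; apply: (bddD bf); exact: bddN. Qed.

Lemma bdd_sum (I : Type) (s : seq I) (F : I -> T -> R) :
  (forall i, bdd (F i)) -> bdd (fun x => \sum_(i <- s) F i x).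
Proof.
move=> bF; elim: s => [|i s IH].
  by under eq_fun do rewrite big_nil; exact: bdd_cst.
by under eq_fun do rewrite big_cons; exact: bddD.
Qed.

Lemma bdd_measurable f : bdd f -> measurable_fun setT f.
Proof. by case. Qed.

Lemma ae_le_bdd f g : measurable_fun setT f -> bdd g ->
  {ae P, forall x, `|f x| <= `|g x|} -> bdd f.
Proof.
move=> mf [_ [C Cg]] fg; split=> //; exists C.
by apply: filterS2 Cg fg => x Cx fx; exact: le_trans Cx.
Qed.

Lemma bdd_integrable f : bdd f -> P.-integrable setT (EFin \o f).
Proof.
move=> [mf [C Cf]]; apply/integrableP; split; first exact/measurable_EFinP.
apply: (@le_lt_trans _ _ (\int[P]_x (Num.max C 0)%:E)%E).
  apply: ae_ge0_le_integral => //.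
  - by apply/measurable_EFinP; exact: measurableT_comp.
  - by move=> x _; rewrite lee_fin le_max lexx orbT.
  - by apply: filterS Cf => x Cx _; rewrite lee_fin le_max Cx.
by rewrite integral_cst//= probability_setT mule1 ltry.
Qed.

Lemma integral_bdd f : bdd f ->
  (\int[P]_x (f x)%:E)%E = (\int[P]_x f x)%:E.
Proof.
move=> bf; rewrite /Rintegral fineK//.
exact: integrable_fin_num (bdd_integrable bf).
Qed.

Lemma RintegralD_bdd f g : bdd f -> bdd g ->
  \int[P]_x (f x + g x) = \int[P]_x f x + \int[P]_x g x.
Proof. by move=> bf bg; rewrite RintegralD//; exact: bdd_integrable. Qed.

Lemma RintegralB_bdd f g : bdd f -> bdd g ->
  \int[P]_x (f x - g x) = \int[P]_x f x - \int[P]_x g x.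
Proof. by move=> bf bg; rewrite RintegralB//; exact: bdd_integrable. Qed.

Lemma RintegralZl_bdd (c : R) f : bdd f -> \int[P]_x (c * f x) = c * \int[P]_x f x.
Proof. by move=> bf; rewrite RintegralZl//; exact: bdd_integrable. Qed.

Lemma RintegralZr_bdd (c : R) f : bdd f -> \int[P]_x (f x * c) = (\int[P]_x f x) * c.
Proof. by move=> bf; rewrite RintegralZr//; exact: bdd_integrable. Qed.

Lemma Rintegral_prob_cst (c : R) : \int[P]_x c = c.
Proof. by rewrite Rintegral_cst//= probability_setT mulr1. Qed.

Lemma Rintegral_sum_bdd (I : Type) (s : seq I) (F : I -> T -> R) :
  (forall i, bdd (F i)) ->
  \int[P]_x (\sum_(i <- s) F i x) = \sum_(i <- s) \int[P]_x F i x.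
Proof.
move=> bF; elim: s => [|i s IH].
  by under eq_Rintegral do rewrite big_nil; rewrite Rintegral_prob_cst big_nil.
under eq_Rintegral do rewrite big_cons.
by rewrite RintegralD_bdd// ?IH ?big_cons//; exact: bdd_sum.
Qed.

Lemma eq_RintegralT f g : f =1 g -> \int[P]_x f x = \int[P]_x g x.
Proof. by move=> fg; apply: eq_Rintegral => x _. Qed.

Lemma ae_eq_Rintegral f g : measurable_fun setT f -> measurable_fun setT g ->
  {ae P, forall x, f x = g x} -> \int[P]_x f x = \int[P]_x g x.
Proof.
move=> mf mg fg; congr fine; apply: ae_eq_integral => //.
- exact/measurable_EFinP.
- exact/measurable_EFinP.
- by apply: filterS fg => x -> _.
Qed.

Lemma ae_Rintegral_ge0 f : measurable_fun setT f -> {ae P, forall x, 0 <= f x} ->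
  0 <= \int[P]_x f x.
Proof.
move=> mf f0; rewrite (@ae_eq_Rintegral _ (fun x => `|f x|)) ?Rintegral_ge0//.
  exact: measurableT_comp.
by apply: filterS f0 => x fx; rewrite ger0_norm.
Qed.

Lemma ae_le_Rintegral f g : bdd f -> bdd g -> {ae P, forall x, f x <= g x} ->
  \int[P]_x f x <= \int[P]_x g x.
Proof.
move=> bf bg fg; rewrite -subr_ge0 -RintegralB_bdd// ae_Rintegral_ge0//.
  by apply: bdd_measurable; exact: bddB.
by apply: filterS fg => x; rewrite subr_ge0.
Qed.

Lemma Rintegral0_ae f : P.-integrable setT (EFin \o f) ->
  (forall x, 0 <= f x) -> \int[P]_x f x = 0 -> {ae P, forall x, f x = 0}.
Proof.
move=> intf f0 If0.
have : (\int[P]_x `|(EFin \o f) x|)%E = 0%E.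
  under eq_integral => x _ do rewrite /= ger0_norm//.
  transitivity (\int[P]_x f x)%:E; last by rewrite If0.
  by rewrite fineK//; exact: integrable_fin_num intf.
move/ae_eq_integral_abs => /(_ measurableT) H.
have : ae_eq P setT (EFin \o f) (cst 0%E) by apply: H; case/integrableP: intf.
by apply: filterS => x /(_ I) [].
Qed.

(** The quadratic form s, t |-> E (s f - t g)^2 is nonnegative; its value at
    (E g^2, E f g) gives the inequality when E g^2 is positive. *)
Lemma cauchy_schwarz f g : bdd f -> bdd g ->
  (\int[P]_x (f x * g x)) ^+ 2 <=
  (\int[P]_x (f x * f x)) * (\int[P]_x (g x * g x)).
Proof.
move=> bf bg.
set a := \int[P]_x (f x * f x); set b := \int[P]_x (g x * g x).
set c := \int[P]_x (f x * g x).
have K s t : 0 <= s ^+ 2 * a + t ^+ 2 * b - (s * t * 2) * c.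
  have : 0 <= \int[P]_x ((s * f x - t * g x) * (s * f x - t * g x)).
    by apply: Rintegral_ge0 => x _; rewrite -expr2 sqr_ge0.
  rewrite (@eq_RintegralT _ (fun x => s ^+ 2 * (f x * f x) + t ^+ 2 * (g x * g x)
      - (s * t * 2) * (f x * g x))); last by move=> x; ring.
  have bff := bddM bf bf; have bgg := bddM bg bg; have bfg := bddM bf bg.
  rewrite RintegralB_bdd ?RintegralD_bdd ?RintegralZl_bdd//; last exact: bddZ.
  - exact: bddZ.
  - exact: bddZ.
  - by apply: bddD; exact: bddZ.
have a0 : 0 <= a by apply: Rintegral_ge0 => x _; rewrite -expr2 sqr_ge0.
have b0 : 0 <= b by apply: Rintegral_ge0 => x _; rewrite -expr2 sqr_ge0.
have [b_0|bn0] := eqVneq b 0.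
  rewrite b_0 mulr0; have [->|c0] := eqVneq c 0; first by rewrite expr0n.
  (* the form is then affine in t, and would be negative at this t *)
  have := K 1 ((a + 1) / (2 * c)); rewrite b_0 mulr0.
  have -> : 1 * ((a + 1) / (2 * c)) * 2 * c = a + 1 by field.
  by move=> H; exfalso; lra.
have H5 := K b c.
have bp : 0 < b by rewrite lt_def bn0.
have : 0 <= b * (a * b - c ^+ 2) by move: H5; nra.
by rewrite pmulr_rge0// subr_ge0.
Qed.

Lemma Lnorm2_bdd f : bdd f ->
  (Lnorm P 2%:E (EFin \o f) = ((\int[P]_x (f x * f x)) `^ 2^-1)%:E)%E.
Proof.
move=> bf; rewrite unlock /=.
under eq_integral do rewrite powR_mulrn// real_normK ?num_real// expr2.
by rewrite integral_bdd//; exact: bddM.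
Qed.

Lemma bdd_Lfun2 f : bdd f -> f \in Lfun P 2%:E.
Proof.
move=> bf; have [mf _] := bf.
rewrite inE /=; apply/andP; split; rewrite inE//=.
by rewrite /finite_norm/= Lnorm2_bdd// ltry.
Qed.

Lemma expectation_bdd f : bdd f -> ('E_P[f] = (\int[P]_x f x)%:E)%E.
Proof. by move=> bf; rewrite unlock integral_bdd. Qed.

Lemma variance_bdd f : bdd f ->
  ('V_P[f] = (\int[P]_x (f x * f x) - (\int[P]_x f x) ^+ 2)%:E)%E.
Proof.
move=> bf; rewrite varianceE ?bdd_Lfun2//.
have -> : f ^+ 2 = (fun x => f x * f x) by apply/funext.
by rewrite !expectation_bdd//; exact: bddM.
Qed.

End EssBounded.

(** * Laws, products and powers *)

(** Distributions, coordinates of products and of powers, and the design X are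
    handled uniformly by a relation between a map and the law of its values. *)
Definition has_law (d1 d2 : measure_display) (T : measurableType d1)
    (U : measurableType d2) (R : realType) (P : probability T R) (X : T -> U)
    (Q : probability U R) : Prop :=
  measurable_fun setT X /\ forall B, measurable B -> P (X @^-1` B) = Q B.

Section Law.
Context (d1 d2 : measure_display) (T : measurableType d1)
  (U : measurableType d2) (R : realType).
Variables (P : probability T R) (X : T -> U) (Q : probability U R).

Hypothesis XQ : has_law P X Q.

Lemma law_ae (A : U -> Prop) :
  {ae Q, forall y, A y} -> {ae P, forall x, A (X x)}.
Proof.
move: XQ => [mX PXQ] [N [mN N0 AN]]; exists (X @^-1` N); split.
- by rewrite -[X in measurable X]setTI; exact: mX.
- by rewrite PXQ.
- by move=> x /= Ax; apply: AN.
Qed.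

Lemma law_ae_inv (A : set U) : measurable A ->
  {ae P, forall x, A (X x)} -> {ae Q, forall y, A y}.
Proof.
move: XQ => [mX PXQ] mA /negligibleP nA.
exists (~` A); split=> //; first exact: measurableC.
rewrite -PXQ; last exact: measurableC.
apply: nA.
have -> : ~` (fun x => A (X x)) = X @^-1` (~` A) by [].
by rewrite -[X in measurable X]setTI; apply: mX => //; exact: measurableC.
Qed.

Lemma law_bdd (f : U -> R) :
  ess_bounded Q f -> ess_bounded P (fun x => f (X x)).
Proof.
move=> [mf [C Cf]]; split; first exact: measurableT_comp XQ.1.
by exists C; exact: (law_ae Cf).
Qed.

Lemma law_bdd_inv (f : U -> R) : measurable_fun setT f ->
  ess_bounded P (fun x => f (X x)) -> ess_bounded Q f.
Proof.
move=> mf [_ [C Cf]]; split=> //; exists C.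
apply: law_ae_inv Cf.
rewrite (_ : (fun _ => _) = (Num.norm \o f) @^-1` `]-oo, C]); last first.
  by apply/seteqP; split => x /=; rewrite in_itv.
rewrite -[X in measurable X]setTI.
by apply: measurableT_comp.
Qed.

Lemma law_integral (f : U -> R) : ess_bounded Q f ->
  \int[P]_x f (X x) = \int[Q]_y f y.
Proof.
move=> bf; have [mX PXQ] := XQ.
have mf : measurable_fun setT (EFin \o f).
  by apply/measurable_EFinP; exact: bdd_measurable bf.
have iP : P.-integrable (X @^-1` setT) ((EFin \o f) \o X).
  by rewrite preimage_setT; exact: bdd_integrable (law_bdd bf).
have := integral_pushforward mX mf iP measurableT.
rewrite preimage_setT /= => H; congr fine; rewrite -H.
by apply: eq_measure_integral => A mA _; exact: PXQ.
Qed.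

End Law.

Lemma has_law_comp (d1 d2 d3 : measure_display) (T : measurableType d1)
    (U : measurableType d2) (V : measurableType d3) (R : realType)
    (P : probability T R) (X : T -> U) (Q : probability U R) (Y : U -> V)
    (Q' : probability V R) :
  has_law P X Q -> has_law Q Y Q' -> has_law P (fun x => Y (X x)) Q'.
Proof.
move=> [mX PX] [mY QY]; split; first exact: measurableT_comp.
move=> B mB; rewrite -QY// -PX//.
by rewrite -[X in measurable X]setTI; exact: mY.
Qed.

Section Product.
Context (d1 d2 : measure_display) (T : measurableType d1)
  (U : measurableType d2) (R : realType).
Variables (P : probability T R) (Q : probability U R).
Local Notation PQ := (P \x Q : probability (T * U)%type R)%E.

Lemma has_law_fst : has_law PQ fst P.
Proof.
split=> // B mB.
rewrite (_ : fst @^-1` B = B `*` setT); last first.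
  by apply/seteqP; split => [[x y] //= |[x y] []].
transitivity ((P \x Q)%E (B `*` setT)) => //.
by rewrite product_measure1E//= -[in RHS](mule1 (P B)) -(probability_setT Q).
Qed.

Lemma has_law_snd : has_law PQ snd Q.
Proof.
split=> // B mB.
rewrite (_ : snd @^-1` B = setT `*` B); last first.
  by apply/seteqP; split => [[x y] //= |[x y] []].
transitivity ((P \x Q)%E (setT `*` B)) => //.
by rewrite product_measure1E//= -[in RHS](mul1e (Q B)) -(probability_setT P).
Qed.

Lemma integral_prodM (f : T -> R) (g : U -> R) :
  ess_bounded P f -> ess_bounded Q g ->
  \int[PQ]_z (f z.1 * g z.2) = (\int[P]_x f x) * (\int[Q]_y g y).
Proof.
move=> bf bg.
have b : ess_bounded PQ (fun z => f z.1 * g z.2).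
  by apply: bddM; [exact: (law_bdd has_law_fst)|exact: (law_bdd has_law_snd)].
rewrite /Rintegral -integral12_prod_meas1; last exact: (bdd_integrable b).
rewrite /fubini_F /=.
under eq_integral => x _.
  under eq_integral do rewrite EFinM.
  rewrite integralZl//; last exact: bdd_integrable.
  rewrite integral_bdd// -EFinM.
  over.
exact: RintegralZr_bdd.
Qed.

End Product.

Section Power.
Context (disp : measure_display) (T : measurableType disp) (R : realType).
Variable P : probability T R.

Let has_law_cons n :
  has_law (P \x power_prob P n : probability (T * n.-tuple T)%type R)%E
    (@cons_pair disp T n) (power_prob P n.+1).
Proof. by split. Qed.

Lemma tnth_cons0 n (z : T * n.-tuple T) : tnth (cons_pair z) ord0 = z.1.
Proof. by rewrite (tnth_nth z.1). Qed.

Lemma tnth_consS n (z : T * n.-tuple T) (i : 'I_n) :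
  tnth (cons_pair z) (lift ord0 i) = tnth z.2 i.
Proof. by rewrite !(tnth_nth z.1). Qed.

Lemma has_law_tnth n (i : 'I_n) :
  has_law (power_prob P n) (fun D => tnth D i) P.
Proof.
elim: n i => [[] //|n IH i].
split=> [|B mB]; first exact: measurable_tnth.
have mB' : measurable ((fun D : n.+1.-tuple T => tnth D i) @^-1` B).
  by rewrite -[X in measurable X]setTI; exact: measurable_tnth.
rewrite -(has_law_cons n).2//; case: (unliftP ord0 i) => [j|] ->.
  have H := has_law_comp (has_law_snd P (power_prob P n)) (IH j).
  rewrite -(H.2 _ mB); congr (_ _); apply/seteqP.
  by split=> z /=; rewrite tnth_consS.
rewrite -((has_law_fst P (power_prob P n)).2 _ mB); congr (_ _).
Qed.

(** By induction on n: the first coordinate is independent of the others, by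
    construction of the power. *)
Lemma integral_power_indep n (i l : 'I_n) (f g : T -> R) : i != l ->
  ess_bounded P f -> ess_bounded P g ->
  \int[power_prob P n]_D (f (tnth D i) * g (tnth D l)) =
  (\int[P]_x f x) * (\int[P]_x g x).
Proof.
move=> il bf bg; elim: n i l il => [[] //|n IH i l il].
have b : ess_bounded (power_prob P n.+1)
    (fun D => f (tnth D i) * g (tnth D l)).
  by apply: bddM; apply: (law_bdd (has_law_tnth _)).
rewrite -(law_integral (has_law_cons n) b).
have bt (h : T -> R) (j : 'I_n) : ess_bounded P h ->
    ess_bounded (power_prob P n) (fun D => h (tnth D j)).
  exact: (law_bdd (has_law_tnth _)).
have et (h : T -> R) (j : 'I_n) : ess_bounded P h ->
    \int[power_prob P n]_D h (tnth D j) = \int[P]_x h x.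
  exact: (law_integral (has_law_tnth _)).
case: (unliftP ord0 i) il => [i'|] ->; case: (unliftP ord0 l) => [l'|] -> il.
- rewrite -(IH i' l'); last by apply: contra_neq il => ->.
  rewrite -(law_integral (has_law_snd P (power_prob P n))); last first.
    by apply: bddM; exact: bt.
  by apply: eq_RintegralT => z; rewrite !tnth_consS.
- under eq_RintegralT do rewrite tnth_consS tnth_cons0 mulrC.
  by rewrite (integral_prodM bg (bt _ i' bf)) et// mulrC.
- under eq_RintegralT do rewrite tnth_consS tnth_cons0.
  by rewrite (integral_prodM bf (bt _ l' bg)) et.
- by rewrite eqxx in il.
Qed.

End Power.

(** * Conditional means given the design *)

Section CondMean.
Context (R : realType) (d : nat) (P : probability (obs R d) R).
Local Notation U := (Ucube R d).
Hypothesis unif : uniform_design P.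

Lemma has_law_obsX : has_law P (@obsX R d) U.
Proof. by split=> //; exact: measurableT_comp. Qed.

Let mX B : measurable B -> measurable (@obsX R d @^-1` B).
Proof.
by move=> mB; rewrite -[X in measurable X]setTI; apply: has_law_obsX.1.
Qed.

Lemma is_cond_meanN Z g : P.-integrable setT (EFin \o Z) ->
  is_cond_mean P Z g -> is_cond_mean P (fun o => - Z o) (fun x => - g x).
Proof.
move=> iZ [ig Zg]; split.
  rewrite (_ : _ \o _ = (fun x => (-1)%:E * (EFin \o g) x)%E).
    exact: integrableZl.
  by apply/funext => x /=; rewrite -EFinM mulN1r.
move=> B mB.
under eq_Rintegral do rewrite -mulN1r.
under [RHS]eq_Rintegral do rewrite -mulN1r.
rewrite !RintegralZl ?Zg//.
- by apply: integrableS ig.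
- exact: mX.
- by apply: integrableS iZ => //; exact: mX.
Qed.

(** On the event that g > c, the integral of g - c is that of Z - c, which is
    nonpositive; so this event is negligible. *)
Lemma cond_mean_le (c : R) Z g : P.-integrable setT (EFin \o Z) ->
  is_cond_mean P Z g -> {ae P, forall o, Z o <= c} -> {ae U, forall x, g x <= c}.
Proof.
move=> iZ [ig Zg] Zc.
have mg : measurable_fun setT g.
  by apply/measurable_EFinP; case/integrableP: ig.
pose B := [set x | c < g x].
have mB : measurable B.
  rewrite (_ : B = g @^-1` `]c, +oo[); last first.
    by apply/seteqP; split => x /=; rewrite in_itv /= andbT.
  by rewrite -[X in measurable X]setTI; exact: mg.
pose k := (fun x => g x - c) \_ B.
have ic : U.-integrable setT (EFin \o (fun x => g x - c)).
  rewrite (_ : _ \o _ = (fun x => (EFin \o g) x - (EFin \o cst c) x)%E)//.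
  by apply: integrableB => //; exact: finite_measure_integrable_cst.
have ik : U.-integrable setT (EFin \o k).
  have /(integrable_mkcond _ mB) := integrableS measurableT mB (@subsetT _ _) ic.
  by rewrite /k restrict_EFin.
have k0 x : 0 <= k x.
  rewrite /k patchE; case: ifPn => //; rewrite inE /B /= => /ltW.
  by rewrite subr_ge0.
have : \int[U]_x k x <= 0.
  rewrite -Rintegral_mkcond RintegralB//; last 2 first.
  - exact: integrableS ig.
  - by apply: finite_measure_integrable_cst.
  rewrite -Zg// Rintegral_cst// subr_le0.
  have -> : c * fine (U B) = \int[P]_(o in @obsX R d @^-1` B) c.
    rewrite Rintegral_cst; last exact: mX.
    by congr (_ * fine _); apply: esym; exact: unif.
  have iZB : P.-integrable (@obsX R d @^-1` B) (EFin \o Z).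
    by apply: integrableS iZ => //; exact: mX.
  have icB : P.-integrable (@obsX R d @^-1` B) (EFin \o cst c).
    by apply: finite_measure_integrable_cst; exact: mX.
  rewrite -subr_ge0 -RintegralB//; last exact: mX.
  rewrite Rintegral_mkcond; apply: ae_Rintegral_ge0.
    apply/(measurable_restrictT _ (mX mB)).
    apply: measurable_funB => //.
    by apply/measurable_EFinP; case/integrableP: iZB.
  apply: filterS Zc => o Zo; rewrite patchE; case: ifPn => // _.
  by rewrite subr_ge0.
move=> Ik; have /Rintegral0_ae := ik; move=> /(_ k0) H.
have {H} : {ae U, forall x, k x = 0}.
  by apply: H; apply/eqP; rewrite eq_le Ik Rintegral_ge0.
apply: filterS => x; rewrite /k patchE leNgt; case: ifPn => [xB|].
  by move/eqP; rewrite subr_eq0 => /eqP ->; rewrite ltxx.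
by rewrite notin_setE => nB _; apply/negP => /nB.
Qed.

Lemma cond_mean_bounds (c1 c2 : R) Z g : P.-integrable setT (EFin \o Z) ->
  is_cond_mean P Z g -> {ae P, forall o, c1 <= Z o <= c2} ->
  {ae U, forall x, c1 <= g x <= c2}.
Proof.
move=> iZ Zg Zc.
have H2 : {ae U, forall x, g x <= c2}.
  by apply: cond_mean_le Zg _ => //; apply: filterS Zc => o /andP[].
have H1 : {ae U, forall x, - g x <= - c1}.
  apply: cond_mean_le (is_cond_meanN iZ Zg) _.
    rewrite (_ : _ \o _ = (fun o => (-1)%:E * (EFin \o Z) o)%E).
      exact: integrableZl.
    by apply/funext => x /=; rewrite -EFinM mulN1r.
  by apply: filterS Zc => o /andP[]; rewrite lerN2.
by apply: filterS2 H1 H2 => x; rewrite lerN2 => -> ->.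
Qed.

(** The charge B |-> E[Z; X in B] is dominated by the uniform law, and its
    Radon-Nikodym density is a version.  Without existence the default value of
    [cond_mean] would make [psi] meaningless. *)
Lemma cond_mean_exists Z : P.-integrable setT (EFin \o Z) ->
  exists g, is_cond_mean P Z g.
Proof.
move=> iZ.
have [nu nuE] : exists nu : {charge set (d.-tuple R) -> \bar R},
    forall B, nu B = (\int[P]_(o in @obsX R d @^-1` B) (Z o)%:E)%E.
  unshelve eexists [the charge _ _ of pushforward (induced_charge iZ) (@obsX R d)].
    exact: has_law_obsX.1.
  by [].
have nuU : nu `<< U.
  apply/null_content_dominatesP => B mB UB0; rewrite nuE.
  apply: null_set_integral; first exact: mX.
    by apply: measurable_funTS; exact: measurable_int iZ.
  by rewrite -[RHS]UB0; exact: unif.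
pose g x := fine (Radon_Nikodym nu U x).
have gE : EFin \o g = Radon_Nikodym nu U.
  by apply/funext => x /=; rewrite fineK//; exact: Radon_Nikodym_fin_num.
exists g; split; first by rewrite gE; exact: Radon_Nikodym_integrable.
move=> B mB; rewrite /Rintegral -nuE (Radon_Nikodym_integral nuU mB).
by congr fine; apply: eq_integral => x _; rewrite -gE.
Qed.

Lemma cond_mean_uniq Z g g' :
  is_cond_mean P Z g -> is_cond_mean P Z g' -> {ae U, forall x, g x = g' x}.
Proof.
move=> [ig Zg] [ig' Zg'].
have mg' : measurable_fun setT (EFin \o g') by case/integrableP: ig'.
have : ae_eq U setT (EFin \o g) (EFin \o g').
  apply: integral_ae_eq => // E _ mE.
  have fE h : U.-integrable setT (EFin \o h) ->
      (\int[U]_(x in E) (EFin \o h) x)%E = (\int[U]_(x in E) h x)%:E.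
    move=> ih; rewrite fineK//; apply: integrable_fin_num => //.
    exact: integrableS ih.
  by rewrite !fE// -Zg// -Zg'.
by apply: filterS => x /(_ I) [].
Qed.



End CondMean.

Import HBSimple HBNNSimple.

Lemma bdd_indic (R : realType) (disp : measure_display) (T : measurableType disp)
    (Q : probability T R) (B : set T) : measurable B -> ess_bounded Q (\1_B : T -> R).
Proof.
move=> mB; split; first exact: measurable_indic.
exists 1; apply: aeW => x; rewrite indicE.
by case: (_ \in _); rewrite ?normr1// normr0.
Qed.

Lemma Rintegral_indic (R : realType) (disp : measure_display) (T : measurableType disp)
    (Q : probability T R) (B : set T) (f : T -> R) :
  \int[Q]_(x in B) f x = \int[Q]_x (\1_B x * f x).
Proof.
rewrite Rintegral_mkcond; apply: eq_RintegralT => x.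
by rewrite patchE indicE; case: ifPn => _; rewrite ?mul1r ?mul0r.
Qed.

Section Tower.
Context (R : realType) (d : nat) (P : probability (obs R d) R).
Local Notation U := (Ucube R d).
Hypothesis unif : uniform_design P.
Let lX := has_law_obsX unif.

Lemma cond_mean_bdd Z g :
  ess_bounded P Z -> is_cond_mean P Z g -> ess_bounded U g.
Proof.
move=> bZ Zg; have [mZ [C CZ]] := bZ; split.
  by apply/measurable_EFinP; case: Zg => /integrableP[].
exists C.
have : {ae U, forall x, - C <= g x <= C}.
  apply: cond_mean_bounds (bdd_integrable bZ) Zg _ => //.
  by apply: filterS CZ => o; rewrite ler_norml.
by apply: filterS => x; rewrite ler_norml.
Qed.

(** Both sides are linear in f, agree on indicators by definition of a version,
    and are continuous in f for the L^1 norm since Z and g are essentially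
    bounded; simple functions are dense in L^1. *)
Lemma tower Z g f : ess_bounded P Z -> is_cond_mean P Z g -> ess_bounded U f ->
  \int[P]_o (f (obsX o) * Z o) = \int[U]_x (f x * g x).
Proof.
move=> bZ Zg bf.
have bg := cond_mean_bdd bZ Zg.
pose L h := \int[P]_o (h (obsX o) * Z o) - \int[U]_x (h x * g x).
have L1 (B : set (d.-tuple R)) : measurable B -> L \1_B = 0.
  move=> mB; apply/eqP; rewrite subr_eq0; apply/eqP.
  transitivity (\int[P]_(o in @obsX R d @^-1` B) Z o).
    by rewrite [RHS]Rintegral_indic; apply: eq_RintegralT.
  by rewrite Zg.2// [LHS]Rintegral_indic.
have LS (s : {sfun d.-tuple R >-> R}) :
    ess_bounded U s /\ L s = 0.
  have sE x : s x = \sum_(y <- fset_set (range s)) y * \1_(s @^-1` [set y]) x.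
    by rewrite {1}fimfunE fsbig_finite.
  have ms y : measurable (s @^-1` [set y]) by exact: measurable_sfunP.
  split.
    rewrite (_ : (s : _ -> _) = fun x => \sum_(y <- fset_set (range s))
      y * \1_(s @^-1` [set y]) x); last exact/funext.
    by apply: bdd_sum => y; apply: bddZ; exact: bdd_indic.
  rewrite /L.
  under eq_RintegralT => o do rewrite sE mulr_suml.
  under [X in _ - X]eq_RintegralT => x do rewrite sE mulr_suml.
  have b1 y : ess_bounded U (fun x => y * \1_(s @^-1` [set y]) x).
    by apply: bddZ; exact: bdd_indic.
  rewrite !Rintegral_sum_bdd; last 2 first.
  - by move=> y; exact: bddM.
  - by move=> y; apply: bddM => //; exact: (law_bdd lX (b1 y)).
  rewrite -sumrB big1// => y _.
  transitivity (y * L \1_(s @^-1` [set y])); last by rewrite L1 ?mulr0.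
  rewrite mulrBr -!RintegralZl_bdd//.
  - by congr (_ - _); apply: eq_RintegralT => ?; rewrite mulrA.
  - by apply: bddM => //; exact: bdd_indic.
  - apply: bddM => //; apply: (law_bdd lX (f := \1_(s @^-1` [set y]))).
    exact: bdd_indic.
have [mZ [C CZ]] := bZ; have [mg [D Dg]] := bg.
pose K := `|C| + `|D| + 1.
have K0 : 0 < K by rewrite /K ltr_wpDl.
apply/eqP; rewrite -subr_eq0 -/(L f) -normr_le0; apply/ler_addgt0Pl => e e0.
rewrite addr0.
have [s_ [_ _ s_f]] := approximation_sfun_integrable measurableT (bdd_integrable bf).
have : \forall n \near \oo, (\int[U]_z `|(f z)%:E - (s_ n z)%:E| < (e / K)%:E)%E.
  exact: (s_f _ (open_ereal_lt' (divr_gt0 e0 K0 : (0%:E < (e / K)%:E)%E))).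
case=> n _ /(_ n (leqnn n)) /=.
have [bs Ls] := LS (s_ n).
set s : d.-tuple R -> R := s_ n; rewrite -/s in bs Ls.
have bfs : ess_bounded U (fun x => f x - s x) by exact: bddB.
have bn : ess_bounded U (fun x => `|f x - s x|).
  apply: (ae_le_bdd _ bfs); first exact: measurableT_comp (bdd_measurable bfs).
  by apply: aeW => x; rewrite normr_id.
rewrite (_ : (\int[U]_z _)%E = (\int[U]_x `|f x - s x|)%:E); last first.
  by rewrite -(integral_bdd bn).
rewrite lte_fin ltr_pdivlMr// => /ltW; apply: le_trans.
have bX h : ess_bounded U h -> ess_bounded P (fun o => h (obsX o)).
  exact: (law_bdd lX).
have -> : L f = L (fun x => f x - s x).
  transitivity (L f - L s); first by rewrite Ls subr0.
  rewrite /L; under [in RHS]eq_RintegralT => o do rewrite mulrBl.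
  under [X in _ = _ - X]eq_RintegralT => o do rewrite mulrBl.
  rewrite !RintegralB_bdd; try ring; apply: bddM => //; exact: bX.
rewrite /L.
have H1 : `|\int[P]_o ((f (obsX o) - s (obsX o)) * Z o)| <=
    `|C| * \int[U]_x `|f x - s x|.
  have bfZ : ess_bounded P (fun o => (f (obsX o) - s (obsX o)) * Z o).
    by apply: bddM => //; exact: (bX _ bfs).
  apply: le_trans (le_normr_Rintegral measurableT (bdd_integrable bfZ)) _.
  rewrite -(law_integral lX bn) -RintegralZl_bdd; last exact: bX _ bn.
  apply: ae_le_Rintegral.
  - apply: (ae_le_bdd _ bfZ).
      by apply: measurableT_comp => //; exact: bdd_measurable bfZ.
    by apply: aeW => x; rewrite normr_id.
  - by apply: bddZ; exact: bX _ bn.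
  - apply: filterS CZ => o Co; rewrite normrM mulrC ler_wpM2r//.
    exact: le_trans (ler_norm _).
have H2 : `|\int[U]_x ((f x - s x) * g x)| <= `|D| * \int[U]_x `|f x - s x|.
  have bfZ : ess_bounded U (fun x => (f x - s x) * g x) by exact: bddM.
  apply: le_trans (le_normr_Rintegral measurableT (bdd_integrable bfZ)) _.
  rewrite -RintegralZl_bdd//.
  apply: ae_le_Rintegral.
  - apply: (ae_le_bdd _ bfZ).
      by apply: measurableT_comp => //; exact: bdd_measurable bfZ.
    by apply: aeW => x; rewrite normr_id.
  - exact: bddZ.
  - apply: filterS Dg => o Co; rewrite normrM mulrC ler_wpM2r//.
    exact: le_trans (ler_norm _).
apply: le_trans (ler_normB _ _) _.
have I0 : 0 <= \int[U]_x `|f x - s x| by exact: Rintegral_ge0.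
by move: H1 H2 I0; rewrite /K; nra.
Qed.

(** Expand the product of the centred variables and apply the tower property to
    the versions that [cond_mean] selects, which are almost surely p and b. *)
Lemma psiE p b :
  ess_bounded P (@obsA R d) -> ess_bounded P (@obsY R d) ->
  is_cond_mean P (@obsA R d) p -> is_cond_mean P (@obsY R d) b ->
  psi P = \int[P]_o (obsA o * obsY o) - \int[U]_x (p x * b x).
Proof.
move=> bA bY Ap Yb.
have versionP Z : ess_bounded P Z -> is_cond_mean P Z (cond_mean P Z).
  move=> bZ; have [g Zg] := cond_mean_exists unif (bdd_integrable bZ).
  exact: (xgetI _ Zg).
rewrite /psi /cond_cov.
set p' := cond_mean P (@obsA R d); set b' := cond_mean P (@obsY R d).
have Ap' : is_cond_mean P (@obsA R d) p' by exact: versionP.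
have Yb' : is_cond_mean P (@obsY R d) b' by exact: versionP.
have bp' := cond_mean_bdd bA Ap'; have bb' := cond_mean_bdd bY Yb'.
have bp := cond_mean_bdd bA Ap; have bb := cond_mean_bdd bY Yb.
have bpX := law_bdd lX bp'; have bbX := law_bdd lX bb'.
set Z := (fun o => _) : obs R d -> R.
have bZ : ess_bounded P Z by apply: bddM; exact: bddB.
have Zc := versionP _ bZ.
rewrite (law_integral lX (cond_mean_bdd bZ Zc)).
transitivity (\int[P]_o Z o).
  by have := Zc.2 _ measurableT; rewrite preimage_setT => ->.
transitivity (\int[P]_o (obsA o * obsY o - b' (obsX o) * obsA o -
    (p' (obsX o) * obsY o - p' (obsX o) * b' (obsX o)))).
  by apply: eq_RintegralT => o; rewrite /Z; ring.
have bAY : ess_bounded P (fun o => obsA o * obsY o) by exact: bddM.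
have bbA : ess_bounded P (fun o => b' (obsX o) * obsA o) by exact: bddM.
have bpY : ess_bounded P (fun o => p' (obsX o) * obsY o) by exact: bddM.
have bpb : ess_bounded P (fun o => p' (obsX o) * b' (obsX o)) by exact: bddM.
rewrite (RintegralB_bdd (bddB bAY bbA) (bddB bpY bpb)).
rewrite (RintegralB_bdd bAY bbA) (RintegralB_bdd bpY bpb).
have -> : \int[P]_o (p' (obsX o) * b' (obsX o)) = \int[U]_x (p' x * b' x).
  exact: (law_integral lX (bddM bp' bb')).
rewrite (tower bA Ap' bb') (tower bY Yb' bp') subrr subr0; congr (_ - _).
apply: ae_eq_Rintegral.
- exact: bdd_measurable (bddM bb' bp').
- exact: bdd_measurable (bddM bp bb).
- apply: filterS2 (cond_mean_uniq Ap' Ap) (cond_mean_uniq Yb' Yb) => x -> ->.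
  by rewrite mulrC.
Qed.

End Tower.

(** * Bilinear statistics of two samples *)

Section Average.
Context (disp : measure_display) (T : measurableType disp) (R : realType).
Variables (P : probability T R) (n : nat).
Hypothesis n_gt0 : (0 < n)%N.
Implicit Types f g : T -> R.
Local Notation Q := (power_prob P n).

Definition average f (D : n.-tuple T) : R :=
  n%:R^-1 * \sum_(i < n) f (tnth D i).

Let n0 : n%:R != 0 :> R.
Proof. by rewrite pnatr_eq0 -lt0n. Qed.

Let bt f (i : 'I_n) : ess_bounded P f -> ess_bounded Q (fun D => f (tnth D i)).
Proof. exact: (law_bdd (has_law_tnth P i)). Qed.

Lemma bdd_average f : ess_bounded P f -> ess_bounded Q (average f).
Proof. by move=> bf; apply: bddZ; apply: bdd_sum => i; exact: bt. Qed.

Lemma integral_average f : ess_bounded P f ->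
  \int[Q]_D average f D = \int[P]_z f z.
Proof.
move=> bf; rewrite RintegralZl_bdd; last by apply: bdd_sum => i; exact: bt.
rewrite Rintegral_sum_bdd; last by move=> i; exact: bt.
under eq_bigr do rewrite (law_integral (has_law_tnth P _) bf).
by rewrite sumr_const card_ord -[X in _ * X]mulr_natl mulKf.
Qed.

(** Among the n^2 pairs of indices, n are diagonal and the others independent. *)
Lemma integral_averageM f g : ess_bounded P f -> ess_bounded P g ->
  \int[Q]_D (average f D * average g D) =
  (1 - n%:R^-1) * ((\int[P]_z f z) * (\int[P]_z g z)) +
  n%:R^-1 * \int[P]_z (f z * g z).
Proof.
move=> bf bg.
set a := \int[P]_z f z; set b := \int[P]_z g z; set c := \int[P]_z _.
have bfg i l : ess_bounded Q (fun D => f (tnth D i) * g (tnth D l)).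
  by apply: bddM; exact: bt.
transitivity (\int[Q]_D (n%:R^-1 ^+ 2 *
    \sum_(i < n) \sum_(l < n) f (tnth D i) * g (tnth D l))).
  apply: eq_RintegralT => D; rewrite /average mulrACA -expr2; congr (_ * _).
  by rewrite mulr_suml; apply: eq_bigr => i _; rewrite mulr_sumr.
rewrite RintegralZl_bdd; last by apply: bdd_sum => i; apply: bdd_sum.
rewrite Rintegral_sum_bdd; last by move=> i; apply: bdd_sum.
have rowE i : \int[Q]_D (\sum_(l < n) f (tnth D i) * g (tnth D l)) =
    c + (n%:R - 1) * (a * b).
  rewrite Rintegral_sum_bdd// (bigD1 i)//=; congr (_ + _).
    exact: (law_integral (has_law_tnth P i) (bddM bf bg)).
  rewrite (eq_bigr (fun=> a * b)); last first.
    by move=> l li; apply: integral_power_indep => //; rewrite eq_sym.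
  rewrite sumr_const cardC1 card_ord -[LHS]mulr_natl -subn1 natrB//.
under eq_bigr do rewrite rowE.
rewrite sumr_const card_ord -[X in _ * X = _]mulr_natl.
by field.
Qed.

End Average.

Section TwoSample.
Context (disp : measure_display) (T : measurableType disp) (R : realType).
Variables (P : probability T R) (n : nat).
Hypothesis n_gt0 : (0 < n)%N.
Variables (I : finType) (f g : I -> T -> R).
Hypotheses (bf : forall r, ess_bounded P (f r)) (bg : forall r, ess_bounded P (g r)).

Local Notation Q := (power_prob P n).
Local Notation QQ := (Q \x Q : probability (n.-tuple T * n.-tuple T)%type R)%E.

(** The first component of D feeds g and the second one f, as the nuisance
    estimate is built on the first subsample and evaluated on the second. *)
Definition bilinear_stat (D : n.-tuple T * n.-tuple T) : R :=
  \sum_(r : I) average (f r) D.2 * average (g r) D.1.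

Let bF r : ess_bounded QQ (fun D => average (f r) D.2).
Proof. apply: (law_bdd (has_law_snd Q Q)); exact: bdd_average. Qed.

Let bG r : ess_bounded QQ (fun D => average (g r) D.1).
Proof. apply: (law_bdd (has_law_fst Q Q)); exact: bdd_average. Qed.

Lemma bdd_bilinear_stat : ess_bounded QQ bilinear_stat.
Proof. by apply: bdd_sum => r; exact: bddM. Qed.

Lemma integral_bilinear_stat :
  \int[QQ]_D bilinear_stat D =
  \sum_(r : I) (\int[P]_z f r z) * (\int[P]_z g r z).
Proof.
rewrite Rintegral_sum_bdd; last by move=> r; exact: bddM.
apply: eq_bigr => r _; rewrite mulrC.
under eq_RintegralT do rewrite mulrC.
by rewrite (integral_prodM (bdd_average n (bg r)) (bdd_average n (bf r)))
  !integral_average.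
Qed.

Lemma integral_sum_sqr (h : I -> T -> R) (c : I -> R) :
  (forall r, ess_bounded P (h r)) ->
  \int[P]_z (\sum_(r : I) c r * h r z) ^+ 2 =
  \sum_(r : I) \sum_(s : I) c r * c s * \int[P]_z (h r z * h s z).
Proof.
move=> bh.
have b r s : ess_bounded P (fun z => c r * c s * (h r z * h s z)).
  by apply: bddZ; exact: bddM.
transitivity (\int[P]_z \sum_(r : I) \sum_(s : I) c r * c s * (h r z * h s z)).
  apply: eq_RintegralT => z; rewrite expr2 mulr_suml; apply: eq_bigr => r _.
  by rewrite mulr_sumr; apply: eq_bigr => s _; rewrite mulrACA.
rewrite Rintegral_sum_bdd; last by move=> r; apply: bdd_sum.
apply: eq_bigr => r _; rewrite Rintegral_sum_bdd//.
by apply: eq_bigr => s _; rewrite RintegralZl_bdd//; exact: bddM.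
Qed.

(** Put nu = 1/n.  The second moments of the averages are
    (1 - nu) phi phi + nu a and (1 - nu) gam gam + nu b, where a and b are the
    second moments of f and g; the products sum up to
    (1 - nu)^2 m^2 + nu (1 - nu) (A + B) + nu^2 C, where m is the mean of the
    statistic, A and B are second moments, hence nonnegative, and C is the sum
    of the products a b. *)
Lemma variance_bilinear_stat :
  \int[QQ]_D (bilinear_stat D * bilinear_stat D) -
    (\int[QQ]_D bilinear_stat D) ^+ 2 <=
  n%:R^-1 * (\int[P]_z (\sum_(r : I) (\int[P]_w g r w) * f r z) ^+ 2 +
             \int[P]_z (\sum_(r : I) (\int[P]_w f r w) * g r z) ^+ 2) +
  n%:R^-1 ^+ 2 * \sum_(r : I) \sum_(s : I)
      (\int[P]_z (f r z * f s z)) * (\int[P]_z (g r z * g s z)).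
Proof.
rewrite !integral_sum_sqr// integral_bilinear_stat.
set nu := n%:R^-1.
pose phi r := \int[P]_z f r z; pose gam r := \int[P]_z g r z.
pose a r s := \int[P]_z (f r z * f s z); pose b r s := \int[P]_z (g r z * g s z).
have -> : \int[QQ]_D (bilinear_stat D * bilinear_stat D) =
  \sum_r \sum_s ((1 - nu) * (phi r * phi s) + nu * a r s) *
                ((1 - nu) * (gam r * gam s) + nu * b r s).
  under eq_RintegralT => D.
    rewrite /bilinear_stat mulr_suml.
    under eq_bigr do rewrite mulr_sumr.
    over.
  rewrite Rintegral_sum_bdd; last first.
    by move=> r; apply: bdd_sum => s; apply: bddM; exact: bddM.
  apply: eq_bigr => r _; rewrite Rintegral_sum_bdd; last first.
    by move=> s; apply: bddM; exact: bddM.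
  apply: eq_bigr => s _; rewrite -!integral_averageM// mulrC.
  rewrite -(integral_prodM (bddM (bdd_average n (bg r)) (bdd_average n (bg s)))
    (bddM (bdd_average n (bf r)) (bdd_average n (bf s)))).
  by apply: eq_RintegralT => D; ring.
set B := \sum_r \sum_s phi r * phi s * b r s.
set A := \sum_r \sum_s gam r * gam s * a r s.
set C := \sum_r \sum_s a r s * b r s.
set m := \sum_r phi r * gam r.
have -> : \sum_r \sum_s ((1 - nu) * (phi r * phi s) + nu * a r s) *
                ((1 - nu) * (gam r * gam s) + nu * b r s) =
    (1 - nu) ^+ 2 * m ^+ 2 + nu * (1 - nu) * (A + B) + nu ^+ 2 * C.
  have -> : m ^+ 2 = \sum_r \sum_s (phi r * gam r) * (phi s * gam s).
    by rewrite expr2 mulr_suml; apply: eq_bigr => r _; rewrite mulr_sumr.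
  rewrite /A /B /C -big_split /= !mulr_sumr -!big_split; apply: eq_bigr => r _ /=.
  rewrite -big_split /= !mulr_sumr -!big_split; apply: eq_bigr => s _ /=; ring.
have A0 : 0 <= A.
  by rewrite -[A](integral_sum_sqr gam bf); apply: Rintegral_ge0 => x _; exact: sqr_ge0.
have B0 : 0 <= B.
  by rewrite -[B](integral_sum_sqr phi bg); apply: Rintegral_ge0 => x _; exact: sqr_ge0.
have nu0 : 0 <= nu by rewrite /nu invr_ge0.
have nu1 : nu <= 1 by rewrite /nu invf_le1 ?ltr0n// ler1n.
rewrite -/m -subr_ge0 [X in 0 <= X](_ : _ =
    nu * (2 - nu) * m ^+ 2 + nu ^+ 2 * (A + B)); last first.
  by rewrite -/A -/B -/C; ring.
have nu2 : 0 <= 2 - nu by lra.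
by apply: addr_ge0; apply: mulr_ge0; rewrite ?sqr_ge0 ?addr_ge0 ?mulr_ge0.
Qed.

End TwoSample.

(** * Orthonormal families on the cube *)

Section Orthonormal.
Context (R : realType) (d : nat) (I : finType).
Local Notation U := (Ucube R d).
Implicit Types (f g h : d.-tuple R -> R) (c : I -> R).

Definition orthonormal_family (e : I -> d.-tuple R -> R) : Prop :=
  (forall i, ess_bounded U (e i)) /\
  forall i i', inner (e i) (e i') = (i == i')%:R.

Lemma innerC f g : inner f g = inner g f.
Proof. by apply: eq_RintegralT => x; rewrite mulrC. Qed.

Lemma inner_ge0 f : 0 <= inner f f.
Proof. by apply: Rintegral_ge0 => x _; rewrite -expr2 sqr_ge0. Qed.

Lemma innerDl f g h : ess_bounded U f -> ess_bounded U g -> ess_bounded U h ->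
  inner (fun x => f x + g x) h = inner f h + inner g h.
Proof.
move=> bf bg bh; rewrite -RintegralD_bdd; [|exact: bddM..].
by apply: eq_RintegralT => x; rewrite mulrDl.
Qed.

Lemma innerBl f g h : ess_bounded U f -> ess_bounded U g -> ess_bounded U h ->
  inner (fun x => f x - g x) h = inner f h - inner g h.
Proof.
move=> bf bg bh; rewrite -RintegralB_bdd; [|exact: bddM..].
by apply: eq_RintegralT => x; rewrite mulrBl.
Qed.

Lemma innerZl (a : R) f h : ess_bounded U f -> ess_bounded U h ->
  inner (fun x => a * f x) h = a * inner f h.
Proof.
move=> bf bh; rewrite -RintegralZl_bdd; last exact: bddM.
by apply: eq_RintegralT => x; rewrite mulrA.
Qed.

Lemma inner_suml (J : Type) (s : seq J) (F : J -> d.-tuple R -> R) h :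
  (forall i, ess_bounded U (F i)) -> ess_bounded U h ->
  inner (fun x => \sum_(i <- s) F i x) h = \sum_(i <- s) inner (F i) h.
Proof.
move=> bF bh; rewrite -Rintegral_sum_bdd; last by move=> i; exact: bddM.
by apply: eq_RintegralT => x; rewrite mulr_suml.
Qed.

Lemma inner_combl (e : I -> d.-tuple R -> R) c h :
  (forall i, ess_bounded U (e i)) -> ess_bounded U h ->
  inner (fun x => \sum_i c i * e i x) h = \sum_i c i * inner (e i) h.
Proof.
move=> be bh; rewrite inner_suml//; last by move=> i; exact: bddZ.
by apply: eq_bigr => i _; exact: innerZl.
Qed.

Variable e : I -> d.-tuple R -> R.
Hypothesis one : orthonormal_family e.
Let be := one.1.

Let bcomb c : ess_bounded U (fun x => \sum_i c i * e i x).
Proof. by apply: bdd_sum => i; exact: bddZ. Qed.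

Lemma inner_comb_basis c i : inner (fun x => \sum_i c i * e i x) (e i) = c i.
Proof.
rewrite inner_combl// (bigD1 i)//= one.2 eqxx mulr1 big1 ?addr0// => i' ii'.
by rewrite one.2 (negbTE ii') mulr0.
Qed.

Lemma inner_comb_self c :
  inner (fun x => \sum_i c i * e i x) (fun x => \sum_i c i * e i x) =
  \sum_i c i ^+ 2.
Proof.
rewrite inner_combl//; apply: eq_bigr => i _.
by rewrite innerC inner_comb_basis.
Qed.

(** Pythagoras for the orthogonal projection on the span of e. *)
Lemma inner_residual f : ess_bounded U f ->
  let r := fun x => f x - \sum_i inner f (e i) * e i x in
  inner r r = inner f f - \sum_i inner f (e i) ^+ 2.
Proof.
move=> bf r; rewrite /r; set c := fun i => inner f (e i).
have bc := bcomb c.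
rewrite innerBl//; last exact: bddB.
rewrite innerC innerBl// [in X in _ - X]innerC innerBl//.
rewrite inner_comb_self inner_combl//.
rewrite [X in _ - _ - (X - _)](_ : _ = \sum_i c i ^+ 2); last first.
  rewrite innerC inner_combl//; apply: eq_bigr => i _.
  by rewrite [inner (e i) f]innerC.
rewrite [X in _ - X - _](_ : _ = \sum_i c i ^+ 2); last first.
  by apply: eq_bigr => i _; rewrite [inner (e i) f]innerC.
by rewrite subrr subr0.
Qed.

Lemma bessel f : ess_bounded U f -> \sum_i inner f (e i) ^+ 2 <= inner f f.
Proof. by move=> bf; rewrite -subr_ge0 -inner_residual// inner_ge0. Qed.

(** The inner product of the projections of f and g on the span of e. *)
Definition proj_form f g : R := \sum_i inner f (e i) * inner g (e i).

End Orthonormal.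

Section Estimator.
Context (R : realType) (d : nat) (W : cdv_generators R).
Variables (P : probability (obs R d) R) (C : R) (p b : d.-tuple R -> R).
Local Notation U := (Ucube R d).
Local Notation A := (@obsA R d).
Local Notation Y := (@obsY R d).
Hypothesis unif : uniform_design P.
Hypotheses (AC : {ae P, forall o, `|obsA o| <= C})
           (YC : {ae P, forall o, `|obsY o| <= C}).
Hypotheses (Ap : is_cond_mean P A p) (Yb : is_cond_mean P Y b).
Let lX := has_law_obsX unif.

Lemma measurable_obsA : measurable_fun setT A.
Proof. exact: measurableT_comp. Qed.

Lemma bdd_obsA : ess_bounded P A.
Proof. by split; [exact: measurable_obsA|exists C]. Qed.

Lemma bdd_obsY : ess_bounded P Y.
Proof. by split; [exact: measurable_snd|exists C]. Qed.

Let bA := bdd_obsA.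
Let bY := bdd_obsY.
Let bp : ess_bounded U p := cond_mean_bdd unif bA Ap.
Let bb : ess_bounded U b := cond_mean_bdd unif bY Yb.

Variable j : nat.
Let e := fun m : location d j => scaling W m.
Hypothesis one : orthonormal_family e.
Let be := one.1.
Let beX m : ess_bounded P (fun o => e m (obsX o)).
Proof. exact: (law_bdd lX (be m)). Qed.

(** The products of left and right factors sum up to A Y - A Y' K(X', X), the
    contribution of the pair of an observation of the second subsample and one,
    marked with a prime, of the first. *)
Definition left_factor (r : option (location d j)) (o : obs R d) : R :=
  if r is Some m then - (obsA o * e m (obsX o)) else obsA o * obsY o.

Definition right_factor (r : option (location d j)) (o : obs R d) : R :=
  if r is Some m then obsY o * e m (obsX o) else 1.

Let bl r : ess_bounded P (left_factor r).
Proof. by case: r => [m|] /=; [apply: bddN|]; exact: bddM. Qed.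

Let br r : ess_bounded P (right_factor r).
Proof. by case: r => [m|] /=; [exact: bddM|exact: bdd_cst]. Qed.

Lemma sum_option (F : option (location d j) -> R) :
  \sum_r F r = F None + \sum_m F (Some m).
Proof.
rewrite (bigD1 None)//=; congr (_ + _).
rewrite (reindex_omap Some id) /=; last by case.
by apply: eq_bigl => m; rewrite eqxx.
Qed.

Variable n : nat.
Hypothesis n_gt0 : (0 < n)%N.

Lemma psihatE : psihat W j (n := n) = bilinear_stat left_factor right_factor.
Proof.
have n0 : n%:R != 0 :> R by rewrite pnatr_eq0 -lt0n.
apply/funext => -[D1 D2]; rewrite /bilinear_stat sum_option /psihat /bhat /=.
rewrite /average sumr_const card_ord -[n%:R]/(1 *+ n) mulVf// mulr1.
transitivity (n%:R^-1 * (\sum_(i < n) obsA (tnth D2 i) * obsY (tnth D2 i)) -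
  n%:R^-1 * \sum_(i < n) obsA (tnth D2 i) *
  (n%:R^-1 * \sum_(l < n) obsY (tnth D1 l) *
    proj_kernel W j (obsX (tnth D1 l)) (obsX (tnth D2 i)))).
  rewrite -mulrBr -sumrB; congr (_ * _).
  by apply: eq_bigr => i _; rewrite mulrBr.
congr (_ + _); rewrite -mulrN -sumrN mulr_sumr; apply/esym.
transitivity (\sum_m \sum_(i < n) n%:R^-1 * - (obsA (tnth D2 i) *
   (n%:R^-1 * (\sum_(l < n) obsY (tnth D1 l) *
     (e m (obsX (tnth D1 l)) * e m (obsX (tnth D2 i))))))).
  apply: eq_bigr => m _; rewrite mulr_sumr mulr_suml; apply: eq_bigr => i _.
  rewrite [X in _ * - (_ * (_ * X))](_ : _ =
      (\sum_(l < n) right_factor (Some m) (tnth D1 l)) * e m (obsX (tnth D2 i))).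
    by rewrite /=; ring.
  by rewrite mulr_suml; apply: eq_bigr => l _ /=; ring.
rewrite exchange_big /=; apply: eq_bigr => i _.
rewrite -mulr_sumr sumrN -mulr_sumr -mulr_sumr; congr (_ * - (_ * (_ * _))).
rewrite exchange_big /=; apply: eq_bigr => l _.
by rewrite -mulr_sumr.
Qed.

Lemma bdd_psihat : ess_bounded (sample_law n P) (psihat W j (n := n)).
Proof. by rewrite psihatE; exact: bdd_bilinear_stat. Qed.

(** The factors indexed by m have means - <p, Phi_m> and <b, Phi_m>, and the
    mean of A Y cancels with the one in psi. *)
Lemma integral_psihat : \int[sample_law n P]_D psihat W j D - psi P =
  inner p b - proj_form e p b.
Proof.
rewrite psihatE (psiE unif bA bY Ap Yb) (integral_bilinear_stat n_gt0 bl br).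
rewrite sum_option /= Rintegral_prob_cst mulr1.
have -> : \sum_m (\int[P]_z - (obsA z * e m (obsX z))) *
    (\int[P]_z (obsY z * e m (obsX z))) = - proj_form e p b.
  rewrite /proj_form -sumrN; apply: eq_bigr => m _.
  rewrite /inner -mulNr; congr (_ * _).
    rewrite -mulN1r -[in RHS](eq_RintegralT _ (fun x => mulrC (e m x) (p x))).
    rewrite -(tower unif bA Ap (be m)) -RintegralZl_bdd; last exact: bddM.
    by apply: eq_RintegralT => o; rewrite mulN1r mulrC.
  rewrite -[in RHS](eq_RintegralT _ (fun x => mulrC (e m x) (b x))).
  by rewrite -(tower unif bY Yb (be m)); apply: eq_RintegralT => o; rewrite mulrC.
by rewrite /inner; ring.
Qed.

Hypothesis C_ge0 : 0 <= C.

Let bcomb (c : location d j -> R) :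
  ess_bounded U (fun x => \sum_m c m * e m x).
Proof. by apply: bdd_sum => m; exact: bddZ. Qed.

Lemma sqr_normr_le (x : R) : `|x| <= C -> x ^+ 2 <= C ^+ 2.
Proof. by move=> xC; rewrite -(real_normK (num_real x)) lerXn2r ?nnegrE. Qed.

(** The square is at most 2 Z^2 + 2 V^2 h(X)^2, where h is the combination of
    the basis, and h(X)^2 has mean the sum of the squares of its coefficients. *)
Lemma integral_residual_sqr (Z V : obs R d -> R) (c : location d j -> R) :
  ess_bounded P Z -> ess_bounded P V ->
  {ae P, forall o, `|Z o| <= C ^+ 2} -> {ae P, forall o, `|V o| <= C} ->
  \int[P]_o (Z o - V o * \sum_m c m * e m (obsX o)) ^+ 2 <=
  2 * C ^+ 4 + 2 * C ^+ 2 * \sum_m c m ^+ 2.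
Proof.
move=> bZ bV ZC VC; set h := fun x => \sum_m c m * e m x.
have bh : ess_bounded U h by exact: bcomb.
have bhX := law_bdd lX bh.
have bR : ess_bounded P (fun o => 2 * C ^+ 4 + 2 * C ^+ 2 * (h (obsX o) * h (obsX o))).
  by apply: bddD; [exact: bdd_cst|apply: bddZ; exact: bddM].
apply: (@le_trans _ _ (\int[P]_o (2 * C ^+ 4 + 2 * C ^+ 2 * (h (obsX o) * h (obsX o))))).
  apply: ae_le_Rintegral => //.
    rewrite (_ : (fun _ => _) = fun o => (Z o - V o * h (obsX o)) *
        (Z o - V o * h (obsX o))); last by apply/funext.
    by apply: bddM; apply: bddB => //; exact: bddM.
  apply: filterS2 ZC VC => o Zo /sqr_normr_le V2.
  have Z2 : Z o ^+ 2 <= C ^+ 4.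
    rewrite -(real_normK (num_real (Z o))) (exprM C 2 2).
    by rewrite lerXn2r// nnegrE exprn_ge0.
  have := sqr_ge0 (Z o + V o * h (obsX o)).
  have := ler_wpM2r (sqr_ge0 (h (obsX o))) V2.
  rewrite -/(h (obsX o)); set x := h _; set a := Z o in Z2 *; set y := V o.
  by move=> H1 H2; lra.
rewrite RintegralD_bdd; [|exact: bdd_cst|by apply: bddZ; exact: bddM].
rewrite (RintegralZl_bdd _ (bddM bhX bhX)).
rewrite Rintegral_prob_cst (law_integral lX (bddM bh bh)).
by rewrite -(inner_comb_self one c).
Qed.

Let AYC : {ae P, forall o, `|obsA o * obsY o| <= C ^+ 2}.
Proof. by apply: filterS2 AC YC => o a y; rewrite normrM expr2 ler_pM. Qed.

Lemma inner_self_le (f : d.-tuple R -> R) Z : ess_bounded P Z ->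
  {ae P, forall o, `|Z o| <= C} -> is_cond_mean P Z f -> inner f f <= C ^+ 2.
Proof.
move=> bZ ZC Zf; have bf := cond_mean_bdd unif bZ Zf.
have fC : {ae U, forall x, - C <= f x <= C}.
  apply: (cond_mean_bounds unif (bdd_integrable bZ) Zf).
  by apply: filterS ZC => o; rewrite ler_norml.
apply: le_trans (_ : \int[U]_x C ^+ 2 <= _); last by rewrite Rintegral_prob_cst.
apply: ae_le_Rintegral; [exact: bddM|exact: bdd_cst|].
by apply: filterS fC => x; rewrite -ler_norml -expr2; exact: sqr_normr_le.
Qed.

Lemma inner_cond_mean Z f m : ess_bounded P Z -> is_cond_mean P Z f ->
  \int[P]_o (Z o * e m (obsX o)) = inner f (e m).
Proof.
move=> bZ Zf; rewrite innerC /inner -(tower unif bZ Zf (be m)).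
by apply: eq_RintegralT => o; rewrite mulrC.
Qed.

(** Each of the three terms of [variance_bilinear_stat] is an instance of
    [integral_residual_sqr].  In the first two the coefficients are those of b
    and of p, and Bessel bounds them; in the last one they are Y' Phi_m(X') for
    an independent copy, and their squares sum to at most C^2 k on average. *)
Lemma variance_psihat :
  ('V_(sample_law n P)[fun D => psihat W j D] <=
   (10 * C ^+ 4 * (n%:R^-1 + (resolution d j)%:R / n%:R ^+ 2))%:E)%E.
Proof.
rewrite variance_bdd; last exact: bdd_psihat.
rewrite lee_fin psihatE; apply: le_trans (variance_bilinear_stat n_gt0 bl br) _.
set K : R := (resolution d j)%:R.
have C4 : C ^+ 4 = C ^+ 2 * C ^+ 2 by rewrite -exprD.
have bAY : ess_bounded P (fun o => obsA o * obsY o) by exact: bddM.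
have self_le (f : d.-tuple R -> R) Z : ess_bounded P Z ->
    {ae P, forall o, `|Z o| <= C} -> is_cond_mean P Z f ->
    2 * C ^+ 4 + 2 * C ^+ 2 * \sum_m (inner f (e m)) ^+ 2 <= 4 * C ^+ 4.
  move=> bZ ZC Zf; have := bessel one (cond_mean_bdd unif bZ Zf).
  have := inner_self_le bZ ZC Zf => H1 H2.
  by have := ler_wpM2l (sqr_ge0 C) (le_trans H2 H1); rewrite C4; lra.
have T1 : \int[P]_z (\sum_r (\int[P]_w right_factor r w) * left_factor r z) ^+ 2 <= 4 * C ^+ 4.
  apply: le_trans (self_le _ _ bY YC Yb).
  apply: le_trans (integral_residual_sqr (fun m => inner b (e m)) bAY bA AYC AC).
  rewrite le_eqVlt; apply/orP; left; apply/eqP; apply: eq_RintegralT => z.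
  rewrite sum_option /= Rintegral_prob_cst mul1r mulr_sumr -sumrN; congr ((_ + _) ^+ 2).
  by apply: eq_bigr => m _; rewrite (inner_cond_mean m bY Yb); ring.
have T2 : \int[P]_z (\sum_r (\int[P]_w left_factor r w) * right_factor r z) ^+ 2 <= 4 * C ^+ 4.
  apply: le_trans (self_le _ _ bA AC Ap).
  set q := \int[P]_o (obsA o * obsY o).
  have qC : {ae P, forall o : obs R d, `|q| <= C ^+ 2}.
    apply: aeW => _; apply: le_trans (le_normr_Rintegral measurableT (bdd_integrable bAY)) _.
    rewrite -[leRHS](Rintegral_prob_cst P); apply: ae_le_Rintegral => //; last exact: bdd_cst.
    apply: (ae_le_bdd _ bAY); first exact: measurableT_comp (bdd_measurable bAY).
    by apply: aeW => o; rewrite normr_id.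
  apply: le_trans (integral_residual_sqr (fun m => inner p (e m)) (bdd_cst P q) bY qC YC).
  rewrite le_eqVlt; apply/orP; left; apply/eqP; apply: eq_RintegralT => z.
  rewrite sum_option /= mulr1 mulr_sumr -sumrN; congr ((_ + _) ^+ 2).
  apply: eq_bigr => m _; rewrite -(inner_cond_mean m bA Ap).
  have -> : \int[P]_w - (obsA w * e m (obsX w)) = - \int[P]_w (obsA w * e m (obsX w)).
    rewrite -[RHS]mulN1r -RintegralZl_bdd; last exact: bddM.
    by apply: eq_RintegralT => o; rewrite mulN1r.
  ring.
have T3 : \sum_r \sum_s (\int[P]_z (left_factor r z * left_factor s z)) *
    (\int[P]_z (right_factor r z * right_factor s z)) <= 2 * C ^+ 4 + 2 * C ^+ 4 * K.
  have brr r s : ess_bounded P (fun z => (\int[P]_w (left_factor r w * left_factor s w)) *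
      (right_factor r z * right_factor s z)) by apply: bddZ; exact: bddM.
  have be2 m : ess_bounded P (fun z => e m (obsX z) ^+ 2) by exact: bddM.
  apply: (@le_trans _ _ (\int[P]_z (2 * C ^+ 4 + 2 * C ^+ 4 * \sum_m e m (obsX z) ^+ 2))).
    rewrite [leLHS](_ : _ = \int[P]_z \sum_r \sum_s
        (\int[P]_w (left_factor r w * left_factor s w)) *
        (right_factor r z * right_factor s z)); last first.
      rewrite Rintegral_sum_bdd; last by move=> r; exact: bdd_sum.
      apply: eq_bigr => r _; rewrite Rintegral_sum_bdd//.
      by apply: eq_bigr => s _; rewrite RintegralZl_bdd//; exact: bddM.
    apply: ae_le_Rintegral.
    - by apply: bdd_sum => r; exact: bdd_sum.
    - by apply: bddD; [exact: bdd_cst|apply: bddZ; exact: bdd_sum].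
    apply: filterS YC => o /sqr_normr_le Y2.
    rewrite [leLHS](_ : _ =
        \int[P]_z (\sum_r right_factor r o * left_factor r z) ^+ 2); last first.
      rewrite (integral_sum_sqr (right_factor^~ o) bl).
      by apply: eq_bigr => r _; apply: eq_bigr => s _; rewrite mulrC.
    apply: (@le_trans _ _ (2 * C ^+ 4 + 2 * C ^+ 2 *
        \sum_m (obsY o * e m (obsX o)) ^+ 2)).
      apply: le_trans (integral_residual_sqr
        (fun m => obsY o * e m (obsX o)) bAY bA AYC AC).
      rewrite le_eqVlt; apply/orP; left; apply/eqP; apply: eq_RintegralT => z.
      rewrite sum_option /= mul1r mulr_sumr -sumrN; congr ((_ + _) ^+ 2).
      by apply: eq_bigr => m _; ring.
    have H : \sum_m (obsY o * e m (obsX o)) ^+ 2 <=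
        C ^+ 2 * \sum_m e m (obsX o) ^+ 2.
      rewrite mulr_sumr; apply: ler_sum => m _.
      by rewrite exprMn ler_wpM2r// sqr_ge0.
    by have := ler_wpM2l (sqr_ge0 C) H; rewrite C4; lra.
  rewrite RintegralD_bdd; [|exact: bdd_cst|by apply: bddZ; exact: bdd_sum].
  rewrite Rintegral_prob_cst RintegralZl_bdd ?Rintegral_sum_bdd//; last exact: bdd_sum.
  rewrite (eq_bigr (fun=> 1)); last first.
    move=> m _; rewrite (law_integral lX (bddM (be m) (be m))).
    by transitivity (inner (e m) (e m)); [|rewrite one.2 eqxx].
  rewrite sumr_const card_ffun !card_ord -expnM; lra.
have K1 : 1 <= K by rewrite ler1n /resolution expn_gt0.
set nu : R := n%:R^-1 in T1 T2 T3 *.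
have nu0 : 0 <= nu by rewrite /nu invr_ge0.
rewrite -exprVn -/nu.
have nu2 : 0 <= nu ^+ 2 by exact: sqr_ge0.
have C40 : 0 <= C ^+ 4 by rewrite C4 -expr2 sqr_ge0.
have := ler_wpM2l nu2 T3; have := ler_wpM2l nu0 T1; have := ler_wpM2l nu0 T2.
have := mulr_ge0 nu2 (mulr_ge0 C40 (_ : 0 <= K - 1)); rewrite subr_ge0 => /(_ K1).
have := mulr_ge0 nu0 C40; have := mulr_ge0 nu2 C40.
set t1 := \int[P]_z _; set t2 := \int[P]_z _; set t3 := \sum_r _.
by move=> H0 H1 H2 H3 H4 H5; lra.
Qed.

End Estimator.

(** * Compactly supported generators *)

Section Generators.
Context (R : realType).
Implicit Types f : R -> R.

Lemma regular_continuous (S : nat) f : (1 <= S)%N -> regular S f -> continuous f.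
Proof.
case: S => // S _ [der [L lip]]; case: S der lip => [_ lip|S der _]; last first.
  move=> x; apply: differentiable_continuous; apply/derivable1_diffP.
  exact: (der 0%N).
move=> x; apply/cvgrPdist_lt => e e0.
have L0 : 0 < `|L| + 1 by rewrite ltr_wpDl.
have /cvgrPdist_lt/(_ _ (divr_gt0 e0 L0)) : y @[y --> x] --> x by exact: cvg_id.
apply: filterS => y /=; rewrite ltr_pdivlMr// => H.
apply: (le_lt_trans (lip _ _)); apply: le_lt_trans H.
by rewrite mulrC ler_wpM2l// (le_trans (ler_norm L))// lerDl.
Qed.

Lemma supported_bounded f : compactly_supported f -> continuous f ->
  exists B, forall x, `|f x| <= B.
Proof.
move=> [r fr] cf.
have /compact_bounded[B [_ HB]] : compact (f @` `[- r, r]).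
  apply: continuous_compact; last exact: segment_compact.
  exact: continuous_subspaceT.
exists (`|B| + 1) => x; have [xr|rx] := leP `|x| r.
  apply: HB; first by rewrite (le_lt_trans (ler_norm B))// ltrDl.
  by exists x => //=; rewrite in_itv /= -ler_norml.
by rewrite (fr _ rx) normr0 addr_ge0.
Qed.

(** Near each point of the segment one radius works; compactness makes the
    radius uniform. *)
Lemma heine f (a b : R) : continuous f -> forall e, 0 < e ->
  exists2 delta, 0 < delta & forall x y, a <= x <= b -> `|x - y| < delta ->
    `|f x - f y| < e.
Proof.
move=> cf e e0.
pose G (t : R) x := forall y, `|x - y| < t -> `|f x - f y| < e.
have /compact_near_coveringP/(_ R (0^'+) G _) := @segment_compact R a b.
case.
  move=> x _.
  have /cvgrPdist_lt/(_ (e / 2)) := cf x; rewrite divr_gt0// => /(_ isT).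
  move=> /nbhs_ballP[eta /= eta0 H].
  exists (ball x (eta / 2), [set t | t < eta / 2]) => /=.
    split; first by apply: nbhsx_ballx; rewrite divr_gt0.
    by apply: nbhs_right_lt; rewrite divr_gt0.
  move=> [z t] /= [xz te] y zy.
  rewrite (_ : f z - f y = (f x - f y) - (f x - f z)); last by ring.
  have e2 : e = e / 2 + e / 2 by field.
  rewrite e2 (le_lt_trans (ler_normB _ _))// ltrD//; apply: H.
    rewrite /ball /= (_ : x - y = (x - z) + (z - y)); last by ring.
    rewrite (le_lt_trans (ler_normD _ _))//.
    have -> : eta = eta / 2 + eta / 2 by field.
    by rewrite ltrD// (lt_trans zy).
  by rewrite /ball /= (lt_trans xz)// ltr_pdivrMr// mulr2n mulrDr mulr1 ltrDl.
move=> delta /= delta0 H; exists (delta / 2); first by rewrite divr_gt0.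
move=> x y xab xy.
apply: (H (delta / 2)) => //=.
- by rewrite sub0r normrN gtr0_norm ?divr_gt0// ltr_pdivrMr// mulr2n mulrDr mulr1 ltrDl.
- by rewrite divr_gt0.
Qed.

(** A point sees at most 2 k + 1 integer translates of a function with support
    in [-r, r], where k >= 2 r. *)
Lemma sum_translates_bounded f (B : R) : compactly_supported f ->
  (forall x, `|f x| <= B) ->
  exists K : R, forall (N : nat) y, \sum_(m < N) `|f (y - m%:R)| <= K.
Proof.
move=> [r fr] fB.
have B0 : 0 <= B by apply: le_trans (fB 0).
have [k rk] : exists k : nat, 2 * r <= k%:R.
  by exists (Num.bound `|2 * r|); rewrite (le_trans (ler_norm _))// ltW// archi_boundP.
exists (B * (2 * k).+1%:R) => N y.
pose p (m : nat) := `|y - m%:R| <= r.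
rewrite -(big_mkord xpredT (fun m => `|f (y - m%:R)|)) (bigID p) /=.
rewrite [X in _ + X]big1 ?addr0; last first.
  by move=> m; rewrite -ltNge => /fr ->; rewrite normr0.
apply: (@le_trans _ _ (\sum_(0 <= m < N | p m) B)); first exact: ler_sum.
rewrite big_const_seq iter_addr_0 -[leLHS]mulr_natr ler_wpM2l// ler_nat -size_filter.
set s := seq.filter _ _.
case: (posnP (size s)) => [-> //|s0].
have us : uniq s by rewrite filter_uniq// iota_uniq.
have [n0 n0s] : exists n0, n0 \in s by exists (nth 0%N s 0); rewrite mem_nth.
(* all the visible translates are within distance k of one of them, n0 *)
rewrite -(size_iota (n0 - k) (2 * k).+1); apply: uniq_leq_size => // m ms.
have dist : `|n0%:R - m%:R| <= k%:R :> R.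
  move: n0s ms; rewrite !mem_filter => /andP[pn _] /andP[pm _].
  apply: le_trans rk.
  rewrite (_ : n0%:R - m%:R = (y - m%:R) - (y - n0%:R)); last by ring.
  apply: le_trans (ler_normB _ _) _.
  by move: pn pm; rewrite /p; lra.
move: dist; rewrite ler_norml => /andP[]; rewrite mem_iota.
rewrite lerBlDr lerNl opprB lerBlDr -!natrD !ler_nat => H1 H2.
by apply/andP; split; lia.
Qed.

End Generators.

(** * Uniform continuity and wavelets on the cube *)

Section Cube.
Context (R : realType) (d : nat).
Local Notation U := (Ucube R d).
Implicit Types h g : d.-tuple R -> R.

(** Each coordinate has the uniform law, which does not charge the complement
    of [0, 1]. *)
Lemma ae_cube : {ae U, forall x, @cube R d x}.
Proof.
have ae01 : {ae distribution (uniform_prob (@ltr01 R)) (@toR R),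
    forall x : R, 0 <= x <= 1}.
  exists (~` `[0, 1]); split; first exact: measurableC.
    rewrite /distribution /pushforward /= /uniform_prob integral_uniform_pdf.
    rewrite (_ : _ `&` _ = set0) ?integral_set0//.
    by apply/seteqP; split => // x [].
  by move=> x /=; rewrite in_itv.
apply: filter_forall => i.
exact: (law_ae (has_law_tnth _ i) ae01).
Qed.

Definition bounded_on_cube h : Prop :=
  exists B, forall x, @cube R d x -> `|h x| <= B.

Lemma ucD h g : unif_continuous_on_cube h -> unif_continuous_on_cube g ->
  unif_continuous_on_cube (fun x => h x + g x).
Proof.
move=> uh ug e e0; have e2 : 0 < e / 2 by rewrite divr_gt0.
have [a a0 ha] := uh _ e2; have [b b0 gb] := ug _ e2.
exists (Num.min a b); first by rewrite lt_min a0 b0.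
move=> x y cx cy xy; rewrite (_ : _ - _ = (h x - h y) + (g x - g y)); last by ring.
have -> : e = e / 2 + e / 2 by field.
rewrite (le_lt_trans (ler_normD _ _))// ltrD//.
  by apply: ha => // i; have := xy i; rewrite lt_min => /andP[].
by apply: gb => // i; have := xy i; rewrite lt_min => /andP[].
Qed.

Lemma uc_cst (c : R) : unif_continuous_on_cube (fun _ : d.-tuple R => c).
Proof. by move=> e e0; exists 1 => // x y _ _ _; rewrite subrr normr0. Qed.

Lemma ucM h g : bounded_on_cube h -> bounded_on_cube g ->
  unif_continuous_on_cube h -> unif_continuous_on_cube g ->
  unif_continuous_on_cube (fun x => h x * g x).
Proof.
move=> [B hB] [D gD] uh ug e e0.
pose K := `|B| + `|D| + 1.
have K0 : 0 < K by rewrite /K ltr_wpDl.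
have e2 : 0 < e / 2 / K by rewrite !divr_gt0.
have [a a0 ha] := uh _ e2; have [b b0 gb] := ug _ e2.
exists (Num.min a b); first by rewrite lt_min a0 b0.
move=> x y cx cy xy.
rewrite (_ : _ - _ = h x * (g x - g y) + g y * (h x - h y)); last by ring.
have -> : e = K * (e / 2 / K) + K * (e / 2 / K) by field; rewrite gt_eqF.
rewrite (le_lt_trans (ler_normD _ _))// !normrM.
have h1 : `|h x| <= K.
  by rewrite /K (le_trans (hB _ cx))//; have := ler_norm B; have := normr_ge0 D; lra.
have g1 : `|g y| <= K.
  by rewrite /K (le_trans (gD _ cy))//; have := ler_norm D; have := normr_ge0 B; lra.
have H1 : `|g x - g y| < e / 2 / K.
  by apply: gb => // i; have := xy i; rewrite lt_min => /andP[].
have H2 : `|h x - h y| < e / 2 / K.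
  by apply: ha => // i; have := xy i; rewrite lt_min => /andP[].
apply: ltrD.
  apply: (@le_lt_trans _ _ (K * `|g x - g y|)); first by rewrite ler_wpM2r.
  by rewrite ltr_pM2l.
apply: (@le_lt_trans _ _ (K * `|h x - h y|)); first by rewrite ler_wpM2r.
by rewrite ltr_pM2l.
Qed.

Lemma boundedM h g : bounded_on_cube h -> bounded_on_cube g ->
  bounded_on_cube (fun x => h x * g x).
Proof.
move=> [B hB] [D gD]; exists (B * D) => x cx.
by rewrite normrM ler_pM ?hB ?gD.
Qed.

Lemma uc_bounded_prod (I : Type) (s : seq I) (F : I -> d.-tuple R -> R) :
  (forall i, bounded_on_cube (F i) /\ unif_continuous_on_cube (F i)) ->
  bounded_on_cube (fun x => \prod_(i <- s) F i x) /\
  unif_continuous_on_cube (fun x => \prod_(i <- s) F i x).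
Proof.
move=> HF; elim: s => [|i s [IB IU]].
  under eq_fun do rewrite big_nil; split; last exact: uc_cst.
  by exists 1 => x _; rewrite normr1.
under eq_fun do rewrite big_cons; have [Bi Ui] := HF i.
by split; [exact: boundedM|exact: ucM].
Qed.

Lemma uc_sum (I : Type) (s : seq I) (F : I -> d.-tuple R -> R) :
  (forall i, unif_continuous_on_cube (F i)) ->
  unif_continuous_on_cube (fun x => \sum_(i <- s) F i x).
Proof.
move=> HF; elim: s => [|i s IU].
  by under eq_fun do rewrite big_nil; exact: uc_cst.
by under eq_fun do rewrite big_cons; exact: ucD.
Qed.

Lemma ucZ (c : R) h : unif_continuous_on_cube h ->
  unif_continuous_on_cube (fun x => c * h x).
Proof.
move=> uh e e0; have K0 : 0 < `|c| + 1 by rewrite ltr_wpDl.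
have [a a0 ha] := uh _ (divr_gt0 e0 K0); exists a => // x y cx cy xy.
rewrite -mulrBr normrM (@le_lt_trans _ _ ((`|c| + 1) * `|h x - h y|))//.
  by rewrite ler_wpM2r// lerDl.
by rewrite mulrC -ltr_pdivlMr// ha.
Qed.

End Cube.

Section Wavelets.
Context (R : realType) (d S J0 : nat) (W : cdv_generators R).
Hypotheses (S_gt0 : (1 <= S)%N) (W_cdv : cdv_basis W d S J0).
Local Notation U := (Ucube R d).

Let inner_cont w : continuous (inner_piece W w).
Proof. exact: (regular_continuous S_gt0 (cdv_interior W_cdv w).2). Qed.

(** There are finitely many generators, each continuous with compact support. *)
Lemma generators_bounded : exists B : R,
  [/\ forall w x, `|inner_piece W w x| <= B,
      forall w m, (m < edges W)%N -> forall x, `|left_edge W w m x| <= B &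
      forall w m, (m < edges W)%N -> forall x, `|right_edge W w m x| <= B].
Proof.
have [Bi HBi] : exists B : bool -> R, forall w x, `|inner_piece W w x| <= B w.
  apply: (fin_all_exists (P := fun w b => forall x, `|inner_piece W w x| <= b)).
  by move=> w; exact: supported_bounded (cdv_interior W_cdv w).1 (@inner_cont w).
have [Bl HBl] : exists B : bool * 'I_(edges W) -> R, forall (t : bool * 'I_(edges W)) x,
    `|left_edge W t.1 t.2 x| <= B t.
  apply: (fin_all_exists (P := fun (t : bool * 'I_(edges W)) b =>
    forall x, `|left_edge W t.1 t.2 x| <= b)).
  move=> -[w m] /=.
  have [s r] := cdv_left W_cdv w (ltn_ord m).
  exact: supported_bounded s (regular_continuous S_gt0 r).
have [Br HBr] : exists B : bool * 'I_(edges W) -> R, forall (t : bool * 'I_(edges W)) x,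
    `|right_edge W t.1 t.2 x| <= B t.
  apply: (fin_all_exists (P := fun (t : bool * 'I_(edges W)) b =>
    forall x, `|right_edge W t.1 t.2 x| <= b)).
  move=> -[w m] /=.
  have [s r] := cdv_right W_cdv w (ltn_ord m).
  exact: supported_bounded s (regular_continuous S_gt0 r).
have le_sum (T : finType) (F : T -> R) i : F i <= \sum_t `|F t|.
  by rewrite (bigD1 i)//= (le_trans (ler_norm _))// lerDl sumr_ge0.
have ge0 (T : finType) (F : T -> R) : 0 <= \sum_t `|F t| by rewrite sumr_ge0.
exists (\sum_t `|Bi t| + \sum_t `|Bl t| + \sum_t `|Br t|); split.
- move=> w x; apply: le_trans (HBi w x) _.
  by have := le_sum _ Bi w; have := ge0 _ Bl; have := ge0 _ Br; lra.
- move=> w m mE x; apply: le_trans (HBl (w, Ordinal mE) x) _.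
  by have := le_sum _ Bl (w, Ordinal mE); have := ge0 _ Bi; have := ge0 _ Br; lra.
- move=> w m mE x; apply: le_trans (HBr (w, Ordinal mE) x) _.
  by have := le_sum _ Br (w, Ordinal mE); have := ge0 _ Bi; have := ge0 _ Bl; lra.
Qed.

Let right_index (l m : nat) : (m < 2 ^ l)%N -> (2 ^ l - edges W <= m)%N ->
  ((2 ^ l - m).-1 < edges W)%N.
Proof. by move: (2 ^ l)%N (edges W) => N E; lia. Qed.

Lemma wave1_continuous w l m : (m < 2 ^ l)%N -> continuous (wave1 W w l m).
Proof.
move=> ml.
have [g cg gE] : exists2 g : R -> R, continuous g &
    wave1 W w l m = fun x => Num.sqrt (2 ^+ l) * g x.
  rewrite /wave1; case mE: (m < edges W)%N.
    exists (left_edge W w m \o ( *%R (2 ^+ l))) => // x.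
    apply: continuous_comp; first exact: mulrl_continuous.
    exact: (regular_continuous S_gt0 (cdv_left W_cdv w mE).2).
  case mE': (2 ^ l - edges W <= m)%N.
    exists (right_edge W w (2 ^ l - m).-1 \o (fun x => 2 ^+ l * (1 - x))) => // x.
    apply: continuous_comp.
      apply: continuousM; first exact: cst_continuous.
      by apply: continuousB; [exact: cst_continuous|done].
    exact: (regular_continuous S_gt0 (cdv_right W_cdv w (right_index ml mE')).2).
  exists (inner_piece W w \o (fun x => 2 ^+ l * x - m%:R)) => // x.
  apply: continuous_comp; last exact: inner_cont.
  by apply: continuousB; [exact: mulrl_continuous|exact: cst_continuous].
rewrite gE => x.
exact: (continuous_comp (cg x) (@mulrl_continuous _ _ (g x))).
Qed.

(** At most [edges W] functions of each edge, and boundedly many inner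
    translates, are nonzero at a given point. *)
Lemma wave1_overlap : exists K : R, forall w l x,
  \sum_(m < 2 ^ l) `|wave1 W w l m x| <= K * Num.sqrt (2 ^+ l).
Proof.
have [B [Bi Bl Br]] := generators_bounded.
have B0 : 0 <= B by apply: le_trans (Bi true 0).
have [K HK] : exists K : bool -> R, forall w (N : nat) y,
    \sum_(m < N) `|inner_piece W w (y - m%:R)| <= K w.
  apply: (fin_all_exists (P := fun w b => forall (N : nat) y,
    \sum_(m < N) `|inner_piece W w (y - m%:R)| <= b)).
  by move=> w; exact: sum_translates_bounded (cdv_interior W_cdv w).1 (Bi w).
pose E : R := (edges W)%:R.
exists (B * E + B * E + (`|K true| + `|K false|)) => w l x.
rewrite mulrC /wave1.
under eq_bigr do rewrite normrM ger0_norm ?sqrtr_ge0//.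
rewrite -mulr_sumr ler_wpM2l ?sqrtr_ge0//.
have count (p : pred nat) :
    (exists a, forall m, (m < 2 ^ l)%N -> p m -> (a <= m < a + edges W)%N) ->
    \sum_(m < 2 ^ l) (if p m then B else 0) <= B * E.
  move=> [a pa]; rewrite -(big_mkord xpredT (fun m => if p m then B else 0)).
  rewrite -big_mkcond big_const_seq iter_addr_0 -[leLHS]mulr_natr ler_wpM2l// ler_nat.
  rewrite -size_filter -(size_iota a (edges W)); apply: uniq_leq_size.
    by rewrite filter_uniq// iota_uniq.
  move=> m; rewrite mem_filter mem_index_iota mem_iota => /andP[pm /andP[_ ml]].
  exact: pa.
apply: (@le_trans _ _ (\sum_(m < 2 ^ l) ((if (m < edges W)%N then B else 0) +
   (if (2 ^ l - edges W <= m)%N then B else 0) + `|inner_piece W w (2 ^+ l * x - m%:R)|))).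
  apply: ler_sum => m _; case: ifPn => mE.
    rewrite (le_trans (Bl _ _ mE _))// -addrA lerDl addr_ge0//.
    by case: ifP.
  case: ifPn => mE'; last by rewrite !add0r.
  by rewrite (le_trans (Br _ _ (right_index (ltn_ord m) mE') _))// add0r lerDl.
rewrite !big_split /=; apply: lerD; first apply: lerD.
- by apply: (count (fun m => m < edges W)%N); exists 0%N.
- apply: (count (fun m => 2 ^ l - edges W <= m)%N); exists (2 ^ l - edges W)%N => m ml ->.
  by move: (2 ^ l)%N (edges W) ml => N e; lia.
- apply: le_trans (HK _ _ _) _.
  by case: w; rewrite (le_trans (ler_norm _))// ?lerDl ?lerDr.
Qed.

Lemma wavelet_measurable l (iota : orientation d) (m : location d l) :
  measurable_fun setT (wavelet W iota m).
Proof.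
rewrite /wavelet; apply: measurable_prod => i _.
apply: (measurableT_comp _ (measurable_tnth i)).
apply: continuous_measurable_fun; exact: wave1_continuous.
Qed.

(** The sum over the locations of a tensor product is the product of the sums
    over the coordinates, each bounded by [wave1_overlap]. *)
Lemma sum_wavelets_le : exists2 K : R, 0 <= K & forall l (iota : orientation d) x,
  \sum_(m : location d l) `|wavelet W iota m x| <= K * Num.sqrt (2 ^+ l) ^+ d.
Proof.
have [K HK] := wave1_overlap.
have K0 : 0 <= K.
  have := HK true 0%N 0; rewrite expr0 sqrtr1 mulr1; apply: le_trans.
  exact: sumr_ge0.
exists (K ^+ d); first exact: exprn_ge0.
move=> l iota x.
rewrite -exprMn.
have -> : \sum_(m : location d l) `|wavelet W iota m x| =
    \prod_(i < d) \sum_(k < 2 ^ l) `|wave1 W (iota i) l k (tnth x i)|.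
  rewrite bigA_distr_bigA /=; apply: eq_bigr => m _.
  by rewrite /wavelet normr_prod.
rewrite -[X in _ <= _ ^+ X]card_ord -prodr_const; apply: ler_prod => i _.
by rewrite HK sumr_ge0.
Qed.

Lemma bdd_wavelet l (iota : orientation d) (m : location d l) :
  ess_bounded U (wavelet W iota m).
Proof.
split; first exact: wavelet_measurable.
have [K K0 HK] := sum_wavelets_le.
exists (K * Num.sqrt (2 ^+ l) ^+ d); apply: aeW => x.
by apply: le_trans (HK l iota x); rewrite (bigD1 m)//= lerDl sumr_ge0.
Qed.

Lemma uc_wavelet l (iota : orientation d) (m : location d l) :
  unif_continuous_on_cube (wavelet W iota m).
Proof.
apply: (uc_bounded_prod _ _).2 => i; split.
  have [K HK] := wave1_overlap.
  exists (K * Num.sqrt (2 ^+ l)) => x _.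
  by apply: le_trans (HK (iota i) l (tnth x i)); rewrite (bigD1 (m i))//= lerDl sumr_ge0.
move=> e e0.
have [delta delta0 H] := heine 0 1 (@wave1_continuous (iota i) l _ (ltn_ord (m i))) e0.
by exists delta => // x y cx cy xy; apply: H; [exact: cx|exact: xy].
Qed.

End Wavelets.

(** * Projection forms and multiresolution *)

Section Projection.
Context (R : realType) (d : nat).
Local Notation U := (Ucube R d).
Implicit Types f g h : d.-tuple R -> R.

Lemma inner_cube_eq f g h : ess_bounded U f -> ess_bounded U g ->
  ess_bounded U h -> (forall x, cube x -> f x = g x) -> inner f h = inner g h.
Proof.
move=> bf bg bh fg; apply: ae_eq_Rintegral.
- exact: bdd_measurable (bddM bf bh).
- exact: bdd_measurable (bddM bg bh).
- by apply: filterS (ae_cube R d) => x cx; rewrite fg.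
Qed.

(** Parseval for a member of the span. *)
Lemma span_inner (I : finType) (e : I -> d.-tuple R -> R) f g :
  orthonormal_family e -> ess_bounded U f -> cube_span e f -> ess_bounded U g ->
  inner g f = \sum_i inner f (e i) * inner g (e i).
Proof.
move=> one bf [c fE] bg; have be := one.1.
have bc : ess_bounded U (fun x => \sum_i c i * e i x).
  by apply: bdd_sum => i; exact: bddZ.
rewrite innerC (inner_cube_eq bf bc bg fE) inner_combl//.
apply: eq_bigr => i _; rewrite (inner_cube_eq bf bc (be i) fE).
by rewrite inner_comb_basis// [inner g _]innerC.
Qed.

(** Expanding each vector of e in e', then each vector of e' in e, changes the
    sum for one basis into the sum for the other. *)
Lemma proj_form_basis (I J : finType) (e : I -> d.-tuple R -> R)
    (e' : J -> d.-tuple R -> R) f g :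
  orthonormal_family e -> orthonormal_family e' ->
  (forall i, cube_span e' (e i)) -> (forall k, cube_span e (e' k)) ->
  ess_bounded U f -> ess_bounded U g ->
  proj_form e f g = proj_form e' f g.
Proof.
move=> one one' ee' e'e bf bg; rewrite /proj_form.
under eq_bigr => i _.
  rewrite (span_inner one' (one.1 i) (ee' i) bf) mulr_suml.
  over.
rewrite exchange_big /=; apply: eq_bigr => k _.
rewrite (span_inner one (one'.1 k) (e'e k) bg) mulr_sumr.
by apply: eq_bigr => i _; rewrite [inner (e' k) _]innerC; ring.
Qed.

Section Bilinear.
Variables (I : finType) (e : I -> d.-tuple R -> R).
Hypothesis be : forall i, ess_bounded U (e i).

Lemma proj_formC f g : proj_form e f g = proj_form e g f.
Proof. by apply: eq_bigr => i _; rewrite mulrC. Qed.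

Lemma proj_formDl f g h : ess_bounded U f -> ess_bounded U g ->
  proj_form e (fun x => f x + g x) h = proj_form e f h + proj_form e g h.
Proof.
move=> bf bg; rewrite /proj_form -big_split; apply: eq_bigr => i _.
by rewrite innerDl// mulrDl.
Qed.

Lemma proj_formZl a f h : ess_bounded U f ->
  proj_form e (fun x => a * f x) h = a * proj_form e f h.
Proof.
move=> bf; rewrite /proj_form mulr_sumr; apply: eq_bigr => i _.
by rewrite innerZl// mulrA.
Qed.

Definition residual_form f g : R := inner f g - proj_form e f g.

Lemma residual_formC f g : residual_form f g = residual_form g f.
Proof. by rewrite /residual_form innerC proj_formC. Qed.

Lemma residual_formDl f g h : ess_bounded U f -> ess_bounded U g ->
  ess_bounded U h ->
  residual_form (fun x => f x + g x) h = residual_form f h + residual_form g h.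
Proof. by move=> *; rewrite /residual_form innerDl// proj_formDl//; ring. Qed.

Lemma residual_formZl a f h : ess_bounded U f -> ess_bounded U h ->
  residual_form (fun x => a * f x) h = a * residual_form f h.
Proof. by move=> *; rewrite /residual_form innerZl// proj_formZl//; ring. Qed.

Lemma residual_form_perturb f g h (s t : R) :
  ess_bounded U f -> ess_bounded U g -> ess_bounded U h ->
  residual_form (fun x => f x + s * h x) (fun x => g x + t * h x) =
  residual_form f g + s * residual_form h g + t * residual_form f h +
  s * t * residual_form h h.
Proof.
move=> bf bg bh.
have lin f' g' (c : R) : ess_bounded U f' -> ess_bounded U g' ->
    residual_form (fun x => f' x + c * h x) g' =
    residual_form f' g' + c * residual_form h g'.
  by move=> bf' bg'; rewrite residual_formDl ?residual_formZl//; exact: bddZ.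
rewrite lin//; last by apply: bddD => //; exact: bddZ.
by rewrite 2![residual_form _ (fun x => g x + _)]residual_formC !lin//
  [residual_form g f]residual_formC [residual_form g h]residual_formC
  [residual_form h f]residual_formC; ring.
Qed.

End Bilinear.

(** The residual form is <f, g - Pi g>, and the norm of g - Pi g is at most that
    of g. *)
Lemma residual_form_sqr_le (I : finType) (e : I -> d.-tuple R -> R) f g :
  orthonormal_family e -> ess_bounded U f -> ess_bounded U g ->
  residual_form e f g ^+ 2 <= inner f f * inner g g.
Proof.
move=> one bf bg; have be := one.1; pose r x := g x - \sum_i inner g (e i) * e i x.
have bc : ess_bounded U (fun x => \sum_i inner g (e i) * e i x).
  by apply: bdd_sum => i; exact: bddZ.
have br : ess_bounded U r by exact: bddB.
have -> : residual_form e f g = inner f r.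
  rewrite [RHS]innerC innerBl// inner_combl// innerC; congr (_ - _).
  by apply: eq_bigr => i _; rewrite mulrC [inner f _]innerC.
apply: le_trans (cauchy_schwarz bf br) _.
apply: ler_wpM2l; first exact: inner_ge0.
rewrite [leLHS](inner_residual one bg) lerBlDr lerDl.
by apply: sumr_ge0 => i _; exact: sqr_ge0.
Qed.

End Projection.

Section Multiresolution.
Context (R : realType) (d S J0 : nat) (W : cdv_generators R).
Hypotheses (S_gt0 : (1 <= S)%N) (W_cdv : cdv_basis W d S J0).
Local Notation U := (Ucube R d).
Let bw := @bdd_wavelet _ _ _ _ _ S_gt0 W_cdv.
Let basis_inner := let: And3 _ H _ := cdv_orthonormal_basis W_cdv in H.

Definition scalings j := fun m : location d j => scaling W m.
(** All the functions of level j, scaling functions and wavelets together: the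
    second orthonormal basis of the resolution space of level j + 1. *)
Definition level_family j :=
  fun t : (orientation d * location d j)%type => wavelet W t.1 t.2.

Definition detail j (f g : d.-tuple R -> R) : R :=
  \sum_(iota | iota != iota0 d) \sum_(m : location d j)
    inner f (wavelet W iota m) * inner g (wavelet W iota m).

Lemma in_cube_span (I : finType) (e : I -> d.-tuple R -> R) i :
  cube_span e (e i).
Proof.
exists (fun k => (k == i)%:R) => x _.
by rewrite (bigD1 i)//= eqxx mul1r big1 ?addr0// => k /negbTE ->; rewrite mul0r.
Qed.

Lemma wavelet_orth l l' (iota iota' : orientation d) (m : location d l)
    (m' : location d l') : (J0 <= l)%N -> (l < l')%N -> iota' != iota0 d ->
  iota != iota0 d \/ l = J0 ->
  inner (wavelet W iota m) (wavelet W iota' m') = 0.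
Proof.
move=> Jl ll' i' il.
pose t : basis_index d := existT _ l (iota, m).
pose t' : basis_index d := existT _ l' (iota', m').
have /(_ _) H := @basis_inner t t'.
rewrite H.
- case: eqP => // /(congr1 (@tag _ _)) /= E.
  by rewrite E ltnn in ll'.
- by split => //=; case: il => [/eqP|]; [left|right].
- by split => //=; [rewrite (leq_trans Jl)// ltnW|left; exact/eqP].
Qed.

(** The space of level j is spanned by the scaling functions of level J0 and the
    wavelets of the levels below j, all orthogonal to the wavelets of level l. *)
Lemma scaling_orth j l (iota : orientation d) (m : location d j)
    (m' : location d l) : (J0 <= j)%N -> (j <= l)%N -> iota != iota0 d ->
  inner (scaling W m) (wavelet W iota m') = 0.
Proof.
move=> Jj; elim: j Jj l iota m m' => [|j IH] Jj l iota m m' jl i0.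
  pose t : basis_index d := existT _ 0%N (iota0 d, m).
  pose t' : basis_index d := existT _ l (iota, m').
  have J00 : J0 = 0%N by apply/eqP; rewrite -leqn0.
  rewrite (@basis_inner t t').
  - case: eqP => // /(congr1 (fun t : basis_index d => (tagged t).1)) /= E.
    by rewrite -E eqxx in i0.
  - by split => //=; right.
  - by split => //=; [rewrite J00|left; exact/eqP].
move: Jj; rewrite leq_eqVlt => /predU1P[Jj|Jj].
  pose t : basis_index d := existT _ j.+1 (iota0 d, m).
  pose t' : basis_index d := existT _ l (iota, m').
  rewrite (@basis_inner t t').
  - case: eqP => // /(congr1 (fun t : basis_index d => (tagged t).1)) /= E.
    by rewrite -E eqxx in i0.
  - by split => //=; [rewrite Jj|right].
  - by split => //=; [rewrite Jj|left; exact/eqP].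
have := in_cube_span (@scalings j.+1) m.
rewrite -/(resolution_space W d j.+1) (cdv_multiresolution W_cdv)// => -[c cE].
rewrite (inner_cube_eq (bw _ _) _ (bw _ _) cE); last first.
  by apply: bdd_sum => t; apply: bddZ; exact: bw.
rewrite inner_combl; [|by move=> t; exact: bw|exact: bw].
rewrite big1//.
move=> [iota' k] _ /=; have [->|i'] := eqVneq iota' (iota0 d).
  by rewrite [inner _ _](IH _ _ _ _ _ _ i0) ?mulr0// ltnW.
by rewrite wavelet_orth ?mulr0//; left.
Qed.

Lemma scalings_orthonormal j : (J0 <= j)%N -> orthonormal_family (@scalings j).
Proof.
by move=> Jj; split; [move=> m; exact: bw|exact: (cdv_scaling_orthonormal W_cdv Jj)].
Qed.

Lemma wavelet_orthonormal j (iota iota' : orientation d) (m m' : location d j) :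
  (J0 <= j)%N -> iota != iota0 d -> iota' != iota0 d ->
  inner (wavelet W iota m) (wavelet W iota' m') =
  ((iota == iota') && (m == m'))%:R.
Proof.
move=> Jj i i'.
pose t : basis_index d := existT _ j (iota, m).
pose t' : basis_index d := existT _ j (iota', m').
rewrite (@basis_inner t t'); last 2 first.
- by split => //=; left; exact/eqP.
- by split => //=; left; exact/eqP.
by rewrite -tag_eqE /tag_eq /= eqxx tagged_asE /= -pair_eqE.
Qed.

Lemma level_family_orthonormal j : (J0 <= j)%N ->
  orthonormal_family (@level_family j).
Proof.
move=> Jj; split=> [t|[i m] [i' m']]; first exact: bw.
rewrite /level_family /= -pair_eqE /=.
have [->|i0] := eqVneq i (iota0 d); have [->|i'0] := eqVneq i' (iota0 d).
- rewrite ?eqxx /=;  exact: (cdv_scaling_orthonormal W_cdv Jj).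
- rewrite ?(negbTE i'0) ?[iota0 d == _]eq_sym ?(negbTE i'0) /=; exact: scaling_orth.
- by rewrite ?(negbTE i0) innerC; exact: scaling_orth.
- exact: wavelet_orthonormal.
Qed.

Lemma proj_form_succ j f g : (J0 <= j)%N -> ess_bounded U f -> ess_bounded U g ->
  proj_form (@scalings j.+1) f g = proj_form (@scalings j) f g + detail j f g.
Proof.
move=> Jj bf bg.
rewrite (proj_form_basis (scalings_orthonormal (leqW Jj))
  (level_family_orthonormal Jj))//; last 2 first.
- move=> m; rewrite -(cdv_multiresolution W_cdv Jj).
  exact: (in_cube_span (@scalings j.+1) m).
- move=> t; rewrite -/(resolution_space W d j.+1) (cdv_multiresolution W_cdv Jj).
  exact: (in_cube_span (@level_family j) t).
rewrite /proj_form -(pair_bigA _ (fun i m => inner f (wavelet W i m) *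
  inner g (wavelet W i m))) /=.
by rewrite (bigD1 (iota0 d)).
Qed.

Lemma proj_form_telescope j N f g : (J0 <= j)%N -> (j <= N)%N ->
  ess_bounded U f -> ess_bounded U g ->
  proj_form (@scalings N) f g =
  proj_form (@scalings j) f g + \sum_(j <= l < N) detail l f g.
Proof.
move=> Jj jN bf bg; rewrite -(subnKC jN); elim: (N - j)%N => [|k IH].
  by rewrite addn0 big_geq// addr0.
rewrite addnS proj_form_succ//; last by rewrite (leq_trans Jj)// leq_addr.
by rewrite IH big_nat_recr ?leq_addr//= addrA.
Qed.

(** A member of the basis of level l lies in the resolution space of level
    l + 1, where the form is the inner product, and is orthogonal to all the
    details that are added above. *)
Lemma residual_form_basis l N (iota : orientation d) (m : location d l) g :
  (J0 <= l)%N -> (l < N)%N -> iota != iota0 d \/ l = J0 -> ess_bounded U g ->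
  residual_form (@scalings N) (wavelet W iota m) g = 0.
Proof.
move=> Jl lN il bg; apply/eqP; rewrite subr_eq0; apply/eqP.
rewrite (proj_form_telescope (leqW Jl) lN (bw _ _) bg).
rewrite big_nat big1 ?addr0; last first.
  move=> k /andP[lk _]; rewrite /detail big1// => i i0; rewrite big1// => m' _.
  by rewrite wavelet_orth ?mul0r.
rewrite (proj_form_basis (scalings_orthonormal (leqW Jl))
  (level_family_orthonormal Jl))//; last 2 first.
- move=> k; rewrite -(cdv_multiresolution W_cdv Jl).
  exact: (in_cube_span (@scalings l.+1) k).
- move=> t; rewrite -/(resolution_space W d l.+1) (cdv_multiresolution W_cdv Jl).
  exact: (in_cube_span (@level_family l) t).
have := span_inner (level_family_orthonormal Jl) (bw iota m)
  (in_cube_span (@level_family l) (iota, m)) bg.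
by rewrite innerC.
Qed.

(** Up to an error of small norm u, the function f is a finite combination of
    basis functions, on which the residual vanishes at high levels; the residual
    of u is bounded by Cauchy-Schwarz, uniformly in the level. *)
Lemma residual_form_cvg f g (eta : R) : ess_bounded U f -> ess_bounded U g ->
  0 < eta -> exists N0, forall N, (N0 <= N)%N ->
    `|residual_form (@scalings N) f g| <= eta.
Proof.
move=> bf bg eta0.
have G0 := inner_ge0 g.
pose eps := eta / (inner g g + 1).
have G1 : 0 < inner g g + 1 by rewrite ltr_wpDl.
have eps0 : 0 < eps by rewrite divr_gt0.
have [_ _ /(_ f (bdd_Lfun2 bf) eps eps0) [s [sA fs]]] := cdv_orthonormal_basis W_cdv.
pose w (t : basis_index d) := wavelet W (tagged t).1 (tagged t).2.
have bwt t : ess_bounded U (w t) by exact: bw.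
pose h x := \sum_(t <- s) t.1 * w t.2 x.
have bh : ess_bounded U h by apply: bdd_sum => t; exact: bddZ.
pose u x := f x - h x.
have bu : ess_bounded U u by exact: bddB.
have u2 : inner u u < eps ^+ 2.
  move: fs; rewrite -/(EFin \o u) (Lnorm2_bdd bu) lte_fin powR12_sqrt ?inner_ge0//.
  rewrite -/(inner u u) => H.
  by rewrite -(sqr_sqrtr (inner_ge0 u)) ltrXn2r// ?nnegrE ?sqrtr_ge0// ltW.
exists (maxn J0 (\max_(t <- s) (tag t.2).+1)) => N; rewrite geq_max => /andP[JN sN].
have hN : residual_form (@scalings N) h g = 0.
  rewrite /residual_form /proj_form inner_suml//; last by move=> t; exact: bddZ.
  apply/eqP; rewrite subr_eq0; apply/eqP.
  under [RHS]eq_bigr => m _.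
    rewrite inner_suml ?mulr_suml; [over|by move=> t; exact: bddZ|exact: bw].
  rewrite exchange_big /= big_seq [RHS]big_seq; apply: eq_bigr => t ts.
  have [Jt tJ] := sA _ ts.
  have tN : (tag t.2 < N)%N.
    by apply: leq_trans sN; rewrite (big_rem _ ts) /= leq_maxl.
  have : residual_form (@scalings N) (w t.2) g = 0.
    apply: residual_form_basis => //.
    by case: tJ => [/eqP|]; [left|right].
  move/eqP; rewrite subr_eq0 => /eqP H.
  rewrite innerZl// H /proj_form mulr_sumr; apply: eq_bigr => m _.
  by rewrite innerZl ?mulrA//; exact: bw.
have bS m : ess_bounded U (@scalings N m) by exact: bw.
have -> : residual_form (@scalings N) f g = residual_form (@scalings N) u g.
  have -> : f = (fun x => u x + h x) by apply/funext => x; rewrite /u subrK.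
  by rewrite residual_formDl// hN addr0 /u; congr residual_form; apply/funext => x; rewrite addrK.
have := residual_form_sqr_le (scalings_orthonormal JN) bu bg.
move=> H.
rewrite -(@ler_pXn2r _ 2)// ?nnegrE ?normr_ge0 ?(ltW eta0)//.
rewrite real_normK ?num_real//; apply: le_trans H _.
apply: (@le_trans _ _ (eps ^+ 2 * (inner g g + 1) ^+ 2)).
  apply: ler_pM => //; [exact: inner_ge0|exact: ltW|nra].
by rewrite -exprMn /eps divfK// gt_eqF.
Qed.

End Multiresolution.

(** * Hoelder balls and the size of the bias *)

Section Hoelder.
Context (R : realType) (d J0 : nat) (W : cdv_generators R).
Hypothesis d_gt0 : (0 < d)%N.
Local Notation U := (Ucube R d).

Definition weight (gamma : R) (l : nat) : R := 2 `^ (l%:R * (gamma + d%:R / 2)).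

Lemma weight_gt0 gamma l : 0 < weight gamma l.
Proof. by rewrite powR_gt0. Qed.

Definition location0 l : location d l := [ffun=> Ordinal (expn_gt0 2 l)].

Lemma orientation_exists : exists iota : orientation d, iota != iota0 d.
Proof.
exists [ffun=> true]; apply/eqP => /ffunP/(_ (Ordinal d_gt0)).
by rewrite !ffunE.
Qed.

(** The number s is the share of the radius spent on the wavelet coefficients;
    it replaces the extended real norm by real bounds on each coefficient. *)
Lemma hoelder_normP gamma h (M : R) :
  (hoelder_norm W J0 gamma h <= M%:E)%E <->
  exists s : R, [/\ 0 <= s <= M,
    forall m : location d J0,
      weight gamma J0 * `|inner h (scaling W m)| <= M - s &
    forall l (iota : orientation d) (m : location d l), (J0 <= l)%N ->
      iota != iota0 d -> weight gamma l * `|inner h (wavelet W iota m)| <= s].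
Proof.
rewrite /hoelder_norm; set x := _ * _; set A := (X in ereal_sup X).
have x0 : 0 <= x by rewrite mulr_ge0 ?powR_ge0// bigmax_ge_id.
have [iota i0] := orientation_exists.
have A0 : (0 <= ereal_sup A)%E.
  apply: (@le_trans _ _ (weight gamma J0 * `|inner h (wavelet W iota (location0 J0))|)%:E).
    by rewrite lee_fin mulr_ge0// powR_ge0.
  by apply: ereal_sup_ubound; exists J0, iota, (location0 J0); split => //; exact/eqP.
split=> [xM|[s [/andP[s0 sM] HS HW]]].
  have fA : ereal_sup A \is a fin_num.
    rewrite ge0_fin_numE//; apply: le_lt_trans (ltry M).
    by apply: le_trans xM; rewrite leeDr// lee_fin.
  exists (fine (ereal_sup A)).
  have xs : x + fine (ereal_sup A) <= M by rewrite -lee_fin EFinD fineK.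
  have s0 : 0 <= fine (ereal_sup A) by exact: fine_ge0.
  split.
  - by rewrite s0 /= (le_trans _ xs)// lerDr.
  - move=> m; rewrite lerBrDr; apply: le_trans xs; rewrite lerD2r.
    rewrite /x ler_wpM2l ?powR_ge0//.
    exact: (le_bigmax _ (fun m => `|inner h (scaling W m)|)).
  - move=> l i m Jl i1; rewrite -lee_fin fineK//.
    by apply: ereal_sup_ubound; exists l, i, m; split => //; exact/eqP.
rewrite -(subrK s M) EFinD; apply: leeD.
  rewrite lee_fin /x mulrC -ler_pdivlMr ?powR_gt0//; apply: bigmax_le.
    by rewrite divr_ge0 ?powR_ge0// subr_ge0.
  by move=> m _; rewrite ler_pdivlMr ?powR_gt0// mulrC; exact: HS.
apply: ge_ereal_sup => _ [l [i [m [Jl i1 ->]]]].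
by rewrite lee_fin; apply: HW => //; exact/eqP.
Qed.

End Hoelder.

Section UpperBias.
Context (R : realType) (d S J0 : nat) (W : cdv_generators R).
Hypotheses (d_gt0 : (0 < d)%N) (S_gt0 : (1 <= S)%N) (W_cdv : cdv_basis W d S J0).
Variables (alpha beta M : R) (p b : d.-tuple R -> R).
Hypotheses (alpha_gt0 : 0 < alpha) (beta_gt0 : 0 < beta).
Local Notation U := (Ucube R d).
Hypotheses (bp : ess_bounded U p) (bb : ess_bounded U b).
Hypotheses (pH : (hoelder_norm W J0 alpha p <= M%:E)%E)
           (bH : (hoelder_norm W J0 beta b <= M%:E)%E).

Let rho : R := 2 `^ (- (alpha + beta)).

(** Up to the factor rho^l, the weights of the two balls balance the number of
    wavelets of level l and of a given orientation; this is why the details of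
    level l contribute rho^l to the bias. *)
Lemma weightM l : weight d alpha l * weight d beta l * rho ^+ l = (2 ^+ l) ^+ d.
Proof.
have D (r t : R) : 2 `^ r * 2 `^ t = 2 `^ (r + t).
  by rewrite powRD// pnatr_eq0 implybT.
rewrite /weight /rho -(@powR_mulrn _ (2 `^ _)) ?powR_ge0// -powRrM !D.
rewrite -exprM -powR_mulrn// natrM; congr (_ `^ _).
by field.
Qed.

Let coef_le gamma h l (iota : orientation d) (m : location d l) :
  (hoelder_norm W J0 gamma h <= M%:E)%E -> (J0 <= l)%N -> iota != iota0 d ->
  weight d gamma l * `|inner h (wavelet W iota m)| <= M.
Proof.
move=> /(hoelder_normP _ _ d_gt0)[s [/andP[_ sM] _ H]] Jl i0.
exact: le_trans (H _ _ _ Jl i0) sM.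
Qed.

Lemma detail_le l : (J0 <= l)%N ->
  `|detail W l p b| <= 2 ^+ d * M ^+ 2 * rho ^+ l.
Proof.
move=> Jl; rewrite /detail.
set c := M ^+ 2 / (weight d alpha l * weight d beta l).
have w0 : 0 < weight d alpha l * weight d beta l.
  by rewrite mulr_gt0// weight_gt0.
have c0 : 0 <= c by rewrite divr_ge0 ?sqr_ge0// ltW.
apply: (@le_trans _ _ (\sum_(iota : orientation d) \sum_(m : location d l) c)).
  rewrite [leRHS](bigID (fun i => i != iota0 d)) /=.
  apply: le_trans (_ : \sum_(i | i != iota0 d) \sum_(m : location d l) c <= _); last first.
    by rewrite lerDl; apply: sumr_ge0 => i _; exact: sumr_ge0.
  apply: le_trans (ler_norm_sum _ _ _) _; apply: ler_sum => i i0.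
  apply: le_trans (ler_norm_sum _ _ _) _; apply: ler_sum => m _.
  rewrite /c ler_pdivlMr// normrM mulrACA expr2.
  have Hp := coef_le m pH Jl i0; have Hb := coef_le m bH Jl i0.
  by rewrite ler_pM ?mulr_ge0// ?(ltW (weight_gt0 _ _ _))// mulrC.
rewrite !sumr_const !card_ffun !card_ord card_bool -mulrnA -[leLHS]mulr_natr.
rewrite natrM -!natrX natrX natrX -(weightM l) /c.
rewrite le_eqVlt; apply/orP; left; apply/eqP; field.
by rewrite !gt_eqF ?weight_gt0.
Qed.

Let rho_gt0 : 0 < rho. Proof. by rewrite powR_gt0. Qed.

Lemma rho_lt1 : rho < 1.
Proof.
have ab : 0 < alpha + beta by rewrite addr_gt0.
rewrite /rho powRN invf_lt1 ?powR_gt0//.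
have : (1 : R) `^ (alpha + beta) < 2 `^ (alpha + beta).
  by apply: gt0_ltr_powR; rewrite ?nnegrE// ltr1n.
by rewrite powR1.
Qed.

Lemma sum_detail_le j N : (J0 <= j)%N -> (j <= N)%N ->
  `|\sum_(j <= l < N) detail W l p b| <=
  2 ^+ d * M ^+ 2 / (1 - rho) * rho ^+ j.
Proof.
move=> Jj jN; set c := 2 ^+ d * M ^+ 2.
have c0 : 0 <= c by rewrite mulr_ge0 ?sqr_ge0// exprn_ge0.
have r1 : 0 < 1 - rho by rewrite subr_gt0 rho_lt1.
suff : `|\sum_(j <= l < N) detail W l p b| <= c / (1 - rho) * (rho ^+ j - rho ^+ N).
  move/le_trans; apply; rewrite ler_wpM2l ?divr_ge0 ?(ltW r1)//.
  by rewrite gerBl exprn_ge0// ltW.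
rewrite -(subnKC jN); elim: (N - j)%N => [|k IH].
  by rewrite addn0 big_geq// normr0 subrr mulr0.
rewrite addnS big_nat_recr ?leq_addr//= (le_trans (ler_normD _ _))//.
have D := detail_le (leq_trans Jj (leq_addr k j)).
apply: le_trans (lerD IH D) _; rewrite -/c exprS.
rewrite le_eqVlt; apply/orP; left; apply/eqP; field.
by rewrite gt_eqF.
Qed.

(** The residual of level j is a finite sum of details, bounded by a geometric
    series, plus a residual of arbitrarily high level. *)
Lemma residual_form_le j : (J0 <= j)%N ->
  `|residual_form (@scalings _ _ W j) p b| <=
  2 ^+ d * M ^+ 2 / (1 - rho) * rho ^+ j.
Proof.
move=> Jj; apply/ler_addgt0Pr => eta eta0.
have [N0 HN0] := residual_form_cvg S_gt0 W_cdv bp bb eta0.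
pose N := maxn N0 j.
have := HN0 N (leq_maxl _ _).
have jN : (j <= N)%N by exact: leq_maxr.
have := sum_detail_le Jj jN.
have -> : residual_form (@scalings _ _ W j) p b =
    \sum_(j <= l < N) detail W l p b + residual_form (@scalings _ _ W N) p b.
  by rewrite /residual_form (proj_form_telescope S_gt0 W_cdv Jj jN bp bb); ring.
by move=> H1 H2; apply: le_trans (ler_normD _ _) _; exact: lerD.
Qed.

Lemma resolution_powR j :
  (resolution d j)%:R `^ (- ((alpha + beta) / d%:R)) = rho ^+ j.
Proof.
have d0 : d%:R != 0 :> R by rewrite pnatr_eq0 -lt0n.
rewrite /resolution natrX -powR_mulrn// -powRrM /rho.
rewrite -(@powR_mulrn _ (2 `^ _)) ?powR_ge0// -powRrM natrM; congr (_ `^ _).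
by field.
Qed.

End UpperBias.

(** * Perturbations inside the model *)

Section LowerBound.
Context (R : realType) (d S J0 : nat) (W : cdv_generators R).
Hypotheses (d_gt0 : (0 < d)%N) (S_gt0 : (1 <= S)%N) (W_cdv : cdv_basis W d S J0).
Local Notation U := (Ucube R d).
Let bw := @bdd_wavelet _ _ _ _ _ S_gt0 W_cdv.

(** Constants are polynomials of degree 0 < S, hence belong to the coarsest
    resolution space. *)
Lemma inner_cst_wavelet (c : R) l (iota : orientation d) (m : location d l) :
  (J0 <= l)%N -> iota != iota0 d -> inner (fun=> c) (wavelet W iota m) = 0.
Proof.
move=> Jl i0.
have [a aE] : resolution_space W d J0 (fun x => \prod_(i < d) tnth x i ^+ 0).
  by apply: (cdv_polynomials W_cdv (leqnn _)); rewrite big1.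
have -> : inner (fun=> c) (wavelet W iota m) = c * inner (fun=> 1) (wavelet W iota m).
  rewrite -innerZl; [by under [in RHS]eq_fun do rewrite mulr1|exact: bdd_cst|exact: bw].
rewrite (@inner_cube_eq _ _ _ (fun x => \sum_k a k * scaling W k x)).
- rewrite inner_combl; [|by move=> k; exact: bw|exact: bw].
  by rewrite big1 ?mulr0// => k _; rewrite (scaling_orth S_gt0 W_cdv)// mulr0.
- exact: bdd_cst.
- by apply: bdd_sum => k; apply: bddZ; exact: bw.
- exact: bw.
- by move=> x /aE <-; rewrite big1.
Qed.

Variables (iota : orientation d).
Hypothesis iota_neq0 : iota != iota0 d.

(** A single wavelet would be too small a perturbation: using all those of a
    level at once multiplies the bias by their number. *)
Definition ripple j (x : d.-tuple R) : R :=
  \sum_(m : location d j) wavelet W iota m x.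

Lemma bdd_ripple j : ess_bounded U (ripple j).
Proof. by apply: bdd_sum => m; exact: bw. Qed.

Lemma ripple_scaling i j (m : location d i) : (J0 <= i)%N -> (i <= j)%N ->
  inner (ripple j) (scaling W m) = 0.
Proof.
move=> Ji ij; rewrite inner_suml; [|by move=> k; exact: bw|exact: bw].
rewrite big1// => k _.
by rewrite innerC (scaling_orth S_gt0 W_cdv).
Qed.

Lemma ripple_wavelet j l (i : orientation d) (m : location d l) :
  (J0 <= j)%N -> (J0 <= l)%N -> i != iota0 d ->
  inner (ripple j) (wavelet W i m) = ((l == j) && (i == iota))%:R.
Proof.
move=> Jj Jl i0; rewrite inner_suml; [|by move=> k; exact: bw|exact: bw].
case: (ltngtP l j) => lj /=; last 1 first.
- subst l; rewrite (eq_bigr (fun k => ((iota == i) && (k == m))%:R)); last first.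
    by move=> k _; rewrite (wavelet_orthonormal W_cdv).
  rewrite (bigD1 m)//= eqxx andbT big1 ?addr0 1?eq_sym//.
  by move=> k /negbTE ->; rewrite andbF.
- rewrite big1// => k _; rewrite innerC (wavelet_orth W_cdv)//; by left.
- rewrite big1// => k _; rewrite (wavelet_orth W_cdv)//; by left.
Qed.

Lemma ripple_self j : (J0 <= j)%N -> inner (ripple j) (ripple j) = (2 ^+ j) ^+ d.
Proof.
move=> Jj; rewrite inner_suml; [|by move=> k; exact: bw|exact: bdd_ripple].
rewrite (eq_bigr (fun=> 1)); last first.
  by move=> m _; rewrite innerC ripple_wavelet// !eqxx.
by rewrite sumr_const card_ffun !card_ord !natrX.
Qed.

Lemma ripple_le : exists2 K : R, 0 < K & forall gamma j x, 0 < gamma ->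
  `|ripple j x| / weight d gamma j <= K.
Proof.
have [K K0 HK] := sum_wavelets_le S_gt0 W_cdv.
exists (K + 1); first by rewrite ltr_wpDl.
move=> gamma j x g0; rewrite ler_pdivrMr ?weight_gt0//.
apply: le_trans (ler_norm_sum _ _ _) _; apply: le_trans (HK j iota x) _.
apply: (@le_trans _ _ (K * weight d gamma j)); last first.
  by rewrite ler_wpM2r ?lerDl// ltW// weight_gt0.
apply: ler_wpM2l => //.
rewrite -powR12_sqrt ?exprn_ge0// -!powR_mulrn ?powR_ge0// -!powRrM /weight.
apply: ler_powR; first by rewrite ler1n.
rewrite -subr_ge0 [X in 0 <= X](_ : _ = j%:R * gamma); last by field.
by rewrite mulr_ge0// ltW.
Qed.

Variables (C1 C2 : R).
Hypothesis C12 : C1 < C2.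

(** Shrinking [h] towards the middle of the range leaves room for a ripple of
    the size allowed by the smoothness, at every level. *)
Lemma perturbation (gamma M' M : R) h : 0 < gamma -> M' < M ->
  ess_bounded U h -> hoelder_ball W J0 gamma M' h ->
  {ae U, forall x, C1 <= h x <= C2} ->
  exists (h1 : d.-tuple R -> R) (a : R), [/\ 0 < a, ess_bounded U h1 &
    forall j (sigma : R), (J0 <= j)%N -> `|sigma| = 1 ->
      let p x := h1 x + sigma * (a / weight d gamma j) * ripple j x in
      hoelder_ball W J0 gamma M p /\ {ae U, forall x, C1 <= p x <= C2}].
Proof.
move=> g0 M'M bh [uch /(hoelder_normP _ _ d_gt0)[s0 [/andP[s00 s0M] HS HW]]] hC.
have [K K0 HK] := ripple_le.
pose c := (C1 + C2) / 2.
pose Xc := \sum_(m : location d J0) weight d gamma J0 * `|inner (fun=> c) (scaling W m)|.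
have w0 l : 0 <= weight d gamma l by rewrite ltW// weight_gt0.
have Xc0 : 0 <= Xc by apply: sumr_ge0 => m _; exact: mulr_ge0.
(* half of the slack M - M' pays for the scaling coefficients of the constant c *)
pose t := Num.min 1 ((M - M') / 2 / (Xc + 1)).
have X1 : 0 < Xc + 1 by rewrite ltr_wpDl.
have D0 : 0 < (M - M') / 2 by rewrite divr_gt0// subr_gt0.
have t0 : 0 < t by rewrite lt_min ltr01 divr_gt0.
have t1 : t <= 1 by rewrite ge_min lexx.
have tX : t * Xc <= (M - M') / 2.
  have : t <= (M - M') / 2 / (Xc + 1) by rewrite ge_min lexx orbT.
  rewrite ler_pdivlMr// => H; apply: le_trans H.
  by rewrite ler_wpM2l ?(ltW t0)// lerDl.
(* the other half, and the distance from C1 and C2 gained, pay for the ripple *)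
pose a := Num.min ((M - M') / 2) (t * ((C2 - C1) / 2) / K).
have c0 : 0 < (C2 - C1) / 2 by rewrite divr_gt0// subr_gt0.
have a0 : 0 < a by rewrite lt_min D0 divr_gt0// mulr_gt0.
have aM : a <= (M - M') / 2 by rewrite ge_min lexx.
have aK : a * K <= t * ((C2 - C1) / 2).
  by rewrite -ler_pdivlMr// ge_min lexx orbT.
pose h1 x := (1 - t) * h x + t * c.
have bh1 : ess_bounded U h1 by apply: bddD; [exact: bddZ|exact: bdd_cst].
exists h1, a; split => // j sigma Jj s1 p.
pose r := sigma * (a / weight d gamma j).
have pE : p = fun x => h1 x + r * ripple j x by [].
have rE : `|r| = a / weight d gamma j.
  by rewrite /r normrM s1 mul1r gtr0_norm// divr_gt0// weight_gt0.
clearbody r; rewrite pE.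
have bi f : ess_bounded U f -> inner (fun x => h1 x + r * ripple j x) f =
    (1 - t) * inner h f + t * inner (fun=> c) f + r * inner (ripple j) f.
  move=> bf; rewrite innerDl//; last by apply: bddZ; exact: bdd_ripple.
  rewrite /h1 innerDl//; [|exact: bddZ|exact: bdd_cst].
  rewrite (innerZl _ bh bf) (innerZl _ (bdd_ripple j) bf).
  by congr (_ + _ + _); exact: (innerZl t (bdd_cst U c) bf).
split; first split.
- apply: ucD; first by apply: ucD; [exact: ucZ|exact: uc_cst].
  by apply: ucZ; apply: uc_sum => m; exact: uc_wavelet S_gt0 W_cdv _ _ _.
- apply/(hoelder_normP _ _ d_gt0); exists ((1 - t) * s0 + a).
  have t10 : 0 <= 1 - t by rewrite subr_ge0.
  have M'0 : 0 <= M' by exact: le_trans s0M.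
  have tM : (1 - t) * M' <= M' by rewrite ler_piMl// gerBl ltW.
  have ts : (1 - t) * s0 <= (1 - t) * M' by rewrite ler_wpM2l.
  have ts0 : 0 <= (1 - t) * s0 by exact: mulr_ge0.
  split.
  + by apply/andP; split; [rewrite addr_ge0// ltW|lra].
  + move=> m; rewrite bi; last exact: bw.
    rewrite ripple_scaling// mulr0 addr0.
    have Hm := HS m.
    have Xm : weight d gamma J0 * `|inner (fun=> c) (scaling W m)| <= Xc.
      by rewrite /Xc (bigD1 m)//= lerDl sumr_ge0// => k _; exact: mulr_ge0.
    have := ler_normD ((1 - t) * inner h (scaling W m)) (t * inner (fun=> c) (scaling W m)).
    rewrite !normrM (ger0_norm t10) (gtr0_norm t0) => H.
    apply: le_trans (ler_wpM2l (w0 J0) H) _.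
    have := ler_wpM2l t10 Hm; have := ler_wpM2l (ltW t0) Xm.
    set x := `|inner h _|; set y := `|inner _ _|; set w := weight _ _ _ => H1 H2.
    lra.
  + move=> l i m Jl i0; rewrite bi; last exact: bw.
    rewrite inner_cst_wavelet// mulr0 addr0 ripple_wavelet//.
    have Hm := ler_wpM2l t10 (HW _ _ m Jl i0).
    have := ler_normD ((1 - t) * inner h (wavelet W i m)) (r * ((l == j) && (i == iota))%:R).
    rewrite !normrM (ger0_norm t10) => H.
    apply: le_trans (ler_wpM2l (w0 l) H) _.
    rewrite mulrDr mulrCA lerD//.
    rewrite rE; have [-> /=|_] := eqVneq l j; last by rewrite normr0 !mulr0 ltW.
    case: (i == iota); last by rewrite normr0 !mulr0 ltW.
    by rewrite normr1 mulr1 mulrC divfK// gt_eqF ?weight_gt0.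
- apply: filterS hC => x /andP[hC1 hC2]; rewrite /h1.
  have rx : `|r * ripple j x| <= t * ((C2 - C1) / 2).
    apply: le_trans aK; rewrite normrM rE -mulrA ler_wpM2l ?(ltW a0)//.
    by rewrite mulrC HK.
  have t10 : 0 <= 1 - t by rewrite subr_ge0.
  have := ler_wpM2l t10 hC1; have := ler_wpM2l t10 hC2.
  move: rx; rewrite ler_norml => /andP[H1 H2] H3 H4.
  by rewrite /c; apply/andP; split; lra.
Qed.

End LowerBound.

Section GraphLaw.
Context (R : realType) (d : nat).
Local Notation U := (Ucube R d).
Variables (p b : d.-tuple R -> R).
Hypotheses (bp : ess_bounded U p) (bb : ess_bounded U b).

Definition graph (x : d.-tuple R) : obs R d := ((x, p x), b x).

Lemma measurable_graph : measurable_fun setT graph.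
Proof.
apply: measurable_fun_pair; last exact: bdd_measurable bb.
by apply: measurable_fun_pair => //; exact: bdd_measurable bp.
Qed.

(** The bias depends on P only through p and b, so a law under which A and Y
    are functions of X is enough to realize a given pair. *)
Lemma graph_law : exists P : probability (obs R d) R,
  [/\ has_law U graph P, uniform_design P, is_cond_mean P (@obsA R d) p &
      is_cond_mean P (@obsY R d) b].
Proof.
pose F : {mfun d.-tuple R >-> obs R d} :=
  MeasurableFun.Pack (MeasurableFun.Class
    (isMeasurableFun.Build _ _ _ _ graph measurable_graph)).
pose P : probability (obs R d) R := distribution U F.
have lP : has_law U graph P by split; [exact: measurable_graph|].
have cm (Z : obs R d -> R) : measurable_fun setT Z ->
    ess_bounded U (fun x => Z (graph x)) ->
    is_cond_mean P Z (fun x => Z (graph x)).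
  move=> mZ bZ; split; first exact: bdd_integrable bZ.
  move=> B mB; rewrite [LHS]Rintegral_indic [RHS]Rintegral_indic.
  have mXB : measurable (@obsX R d @^-1` B).
    rewrite -[X in measurable X]setTI.
    exact: (measurableT_comp measurable_fst measurable_fst).
  rewrite -(law_integral lP) //.
  by apply: bddM; [exact: bdd_indic|exact: (law_bdd_inv lP)].
exists P; split=> //; apply: cm => //; first exact: measurable_obsA.
exact: measurable_snd.
Qed.

End GraphLaw.

(** * Bias and variance over the model *)

Section Assembly.
Context (R : realType) (d S J0 : nat) (W : cdv_generators R).
Hypotheses (d_gt0 : (0 < d)%N) (S_gt0 : (1 <= S)%N) (W_cdv : cdv_basis W d S J0).
Variables (alpha beta M C1 C2 : R).
Hypotheses (alpha_gt0 : 0 < alpha) (beta_gt0 : 0 < beta).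
Local Notation U := (Ucube R d).
Local Notation rho := (2 `^ (- (alpha + beta)) : R).

Let C : R := `|C1| + `|C2|.

Lemma range_norm (x : R) : C1 <= x <= C2 -> `|x| <= C.
Proof.
move=> /andP[h1 h2]; rewrite ler_norml /C; apply/andP; split.
  by have := ler_norm (- C1); rewrite normrN; have := normr_ge0 C2; lra.
by have := ler_norm C2; have := normr_ge0 C1; lra.
Qed.

Section Member.
Variables (P : probability (obs R d) R) (p b : d.-tuple R -> R).
Hypotheses (unif : uniform_design P)
  (range : {ae P, forall o, C1 <= obsA o <= C2 /\ C1 <= obsY o <= C2})
  (Ap : is_cond_mean P (@obsA R d) p) (Yb : is_cond_mean P (@obsY R d) b).

Let AC : {ae P, forall o, `|obsA o| <= C}.
Proof. by apply: filterS range => o [/range_norm]. Qed.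

Let YC : {ae P, forall o, `|obsY o| <= C}.
Proof. by apply: filterS range => o [_ /range_norm]. Qed.

Lemma member_bias n j : (0 < n)%N -> (J0 <= j)%N ->
  ('E_(sample_law n P)[(fun D => psihat W j D - psi P)%R] =
   (residual_form (@scalings _ _ W j) p b)%:E)%E.
Proof.
move=> n0 Jj; have one := scalings_orthonormal S_gt0 W_cdv Jj.
have bpsi := bdd_psihat unif AC YC one n0.
rewrite expectation_bdd; last by apply: bddB => //; exact: bdd_cst.
rewrite RintegralB_bdd ?Rintegral_prob_cst//; last exact: bdd_cst.
by rewrite (integral_psihat unif AC YC Ap Yb one n0).
Qed.

Lemma member_variance n j : (0 < n)%N -> (J0 <= j)%N ->
  ('V_(sample_law n P)[(fun D => psihat W j D)%R] <=
   (10 * C ^+ 4 * (n%:R^-1 + (resolution d j)%:R / n%:R ^+ 2))%:E)%E.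
Proof.
move=> n0 Jj; have one := scalings_orthonormal S_gt0 W_cdv Jj.
exact: (variance_psihat unif AC YC Ap Yb one n0 (addr_ge0 (normr_ge0 _) (normr_ge0 _))).
Qed.

Lemma member_bdd : ess_bounded U p /\ ess_bounded U b.
Proof.
split; first exact: (cond_mean_bdd unif (bdd_obsA AC) Ap).
exact: (cond_mean_bdd unif (bdd_obsY YC) Yb).
Qed.

Lemma member_range : {ae U, forall x, C1 <= p x <= C2} /\
  {ae U, forall x, C1 <= b x <= C2}.
Proof.
split.
  apply: (cond_mean_bounds unif (bdd_integrable (bdd_obsA AC)) Ap).
  by apply: filterS range => o [].
apply: (cond_mean_bounds unif (bdd_integrable (bdd_obsY YC)) Yb).
by apply: filterS range => o [].
Qed.

End Member.

Lemma graph_law_model (p b : d.-tuple R -> R) :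
  ess_bounded U p -> ess_bounded U b ->
  hoelder_ball W J0 alpha M p -> hoelder_ball W J0 beta M b ->
  {ae U, forall x, C1 <= p x <= C2} -> {ae U, forall x, C1 <= b x <= C2} ->
  exists2 P, model W d J0 alpha beta M C1 C2 P &
    is_cond_mean P (@obsA R d) p /\ is_cond_mean P (@obsY R d) b.
Proof.
move=> bp bb hp hb rp rb; have [P [lP unif Ap Yb]] := graph_law bp bb.
exists P => //; split=> //; [|by exists p|by exists b].
apply: (law_ae_inv lP (A := fun o => C1 <= obsA o <= C2 /\ C1 <= obsY o <= C2)).
  rewrite (_ : (fun _ => _) = (@obsA R d @^-1` `[C1, C2]) `&` (@obsY R d @^-1` `[C1, C2])).
    apply: measurableI; rewrite -[X in measurable X]setTI.
      by apply: measurable_obsA.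
    exact: measurable_snd.
  by apply/seteqP; split=> o /=; rewrite !in_itv.
by apply: filterS2 rp rb.
Qed.

(** The alternating sum of the values of f at the four sign choices is 4 e. *)
Lemma polarization (f : R -> R -> R) (a b c e : R) :
  (forall s t, f s t = a + s * b + t * c + s * t * e) ->
  exists s t, [/\ `|s| = 1, `|t| = 1 & e <= `|f s t|].
Proof.
move=> fE; have N1 : `|-1| = 1 :> R by rewrite normrN1.
have [h1|h1] := leP e `|f 1 1|; first by exists 1, 1; rewrite normr1.
have [h2|h2] := leP e `|f 1 (-1)|; first by exists 1, (-1); rewrite N1 normr1.
have [h3|h3] := leP e `|f (-1) 1|; first by exists (-1), 1; rewrite N1 normr1.
have [h4|h4] := leP e `|f (-1) (-1)|; first by exists (-1), (-1); rewrite N1.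
move: h1 h2 h3 h4; rewrite !ltr_norml !fE.
move=> /andP[_ h1] /andP[h2 _] /andP[h3 _] /andP[_ h4]; exfalso; lra.
Qed.

(** The residual of the two perturbed functions is, up to the terms that
    [polarization] cancels, a a' rho^j. *)
Lemma model_bias_lower : nondegenerate_model W d J0 alpha beta M C1 C2 ->
  exists2 c : R, 0 < c & forall n j, (0 < n)%N -> (J0 <= j)%N ->
    exists2 P, model W d J0 alpha beta M C1 C2 P &
      ((c * rho ^+ j)%:E <=
       `|'E_(sample_law n P)[(fun D => psihat W j D - psi P)%R]|)%E.
Proof.
move=> [C12 [M' M'M [P0 [unif range [p0 Ap0 hp0] [b0 Yb0 hb0]]]]].
have [bp0 bb0] := member_bdd unif range Ap0 Yb0.
have [rp0 rb0] := member_range unif range Ap0 Yb0.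
have [iota i0] := orientation_exists d_gt0.
have [p1 [a [a0 bp1 Hp]]] := perturbation d_gt0 S_gt0 W_cdv i0 C12 alpha_gt0 M'M bp0 hp0 rp0.
have [b1 [a' [a'0 bb1 Hb]]] := perturbation d_gt0 S_gt0 W_cdv i0 C12 beta_gt0 M'M bb0 hb0 rb0.
exists (a * a'); first exact: mulr_gt0.
move=> n j n0 Jj; have one := scalings_orthonormal S_gt0 W_cdv Jj.
have br := bdd_ripple S_gt0 W_cdv iota j.
set e := @scalings _ _ W j in one.
pose r := ripple W iota j.
pose u s x := s * (a / weight d alpha j) * r x.
pose v t x := t * (a' / weight d beta j) * r x.
have bu s : ess_bounded U (u s) by exact: bddZ.
have bv s : ess_bounded U (v s) by exact: bddZ.
pose p s x := p1 x + u s x; pose b t x := b1 x + v t x.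
have bp s : ess_bounded U (p s) by exact: bddD.
have bb t : ess_bounded U (b t) by exact: bddD.
have rr : residual_form e r r = (2 ^+ j) ^+ d.
  rewrite /residual_form /r (ripple_self S_gt0 W_cdv i0 Jj).
  rewrite /proj_form big1 ?subr0// => m _.
  by rewrite (ripple_scaling S_gt0 W_cdv i0 m Jj (leqnn _)) mul0r.
have E s t : residual_form e (p s) (b t) = residual_form e p1 b1 +
    s * (a / weight d alpha j * residual_form e r b1) +
    t * (a' / weight d beta j * residual_form e p1 r) +
    s * t * (a * a' * rho ^+ j).
  rewrite (residual_form_perturb one.1 _ _ bp1 bb1 br) -/r rr.
  rewrite -(weightM _ alpha beta); field.
  by rewrite !gt_eqF ?weight_gt0.
have [s [t [s1 t1 st]]] := polarization E.
have [hp rp] := Hp j s Jj s1; have [hb rb] := Hb j t Jj t1.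
have [P PM [Ap Yb]] := graph_law_model (bp s) (bb t) hp hb rp rb.
exists P => //; have [unifP rangeP _ _] := PM.
by rewrite (member_bias unifP rangeP Ap Yb n0 Jj) lee_fin.
Qed.

End Assembly.

(** * The theorem *)

Theorem theorem3 (R : realType) (d S J0 : nat) (W : cdv_generators R)
    (alpha beta M C1 C2 : R)
    (d_gt0 : (0 < d)%N) (S_gt0 : (1 <= S)%N)
    (alpha_gt0 : 0 < alpha) (beta_gt0 : 0 < beta) (M_gt0 : 0 < M)
    (S_gt : Num.max alpha beta < S%:R) (J0_S : (S <= 2 ^ J0)%N)
    (W_cdv : cdv_basis W d S J0) :
  let Pab := model W d J0 alpha beta M C1 C2 in
  let sup_bias : nat -> nat -> \bar R := fun n j : nat =>
    ereal_sup [set `|'E_(sample_law n P)[(fun D => psihat W j D - psi P)%R]|%E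
              | P in Pab] in
  let sup_var : nat -> nat -> \bar R := fun n j : nat =>
    ereal_sup [set 'V_(sample_law n P)[(fun D => psihat W j D)%R] | P in Pab] in
  let bias_rate : nat -> nat -> \bar R := fun _ j : nat =>
    ((resolution d j)%:R `^ (- ((alpha + beta) / d%:R)))%:E in
  let var_rate : nat -> nat -> \bar R := fun n j : nat =>
    (n%:R^-1 + (resolution d j)%:R / n%:R ^+ 2)%:E in
  [/\ lesssim J0 sup_bias bias_rate,
      nondegenerate_model W d J0 alpha beta M C1 C2 ->
        lesssim J0 bias_rate sup_bias
    & lesssim J0 sup_var var_rate].
Proof.
move=> Pab sup_bias sup_var bias_rate var_rate; split.
- pose rho : R := 2 `^ (- (alpha + beta)).
  have r1 : 0 < 1 - rho by rewrite subr_gt0; exact: rho_lt1.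
  exists (2 ^+ d * M ^+ 2 / (1 - rho)).
    by rewrite divr_gt0// mulr_gt0// exprn_gt0.
  exists 1%N => n j n0 Jj; apply: ge_ereal_sup => _ [P [unif range [p Ap hp] [b Yb hb]] <-].
  have [bp bb] := member_bdd unif range Ap Yb.
  rewrite (member_bias S_gt0 W_cdv unif range Ap Yb n0 Jj) /bias_rate.
  rewrite resolution_powR// -EFinM lee_fin.
  exact: (residual_form_le d_gt0 S_gt0 W_cdv alpha_gt0 beta_gt0 bp bb hp.2 hb.2 Jj).
- move=> /(model_bias_lower d_gt0 S_gt0 W_cdv alpha_gt0 beta_gt0)[c c0 Hc].
  exists c^-1; first by rewrite invr_gt0.
  exists 1%N => n j n0 Jj; have [P PM H] := Hc n j n0 Jj.
  rewrite /bias_rate resolution_powR// lee_pdivlMl//; apply: le_trans H _.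
  by apply: ereal_sup_ubound; exists P.
(* adding 1 keeps the constant positive when C1 = C2 = 0 *)
- exists (10 * (`|C1| + `|C2|) ^+ 4 + 1).
    by rewrite ltr_wpDl// mulr_ge0// exprn_ge0// addr_ge0.
  exists 1%N => n j n0 Jj; apply: ge_ereal_sup => _ [P [unif range [p Ap hp] [b Yb hb]] <-].
  apply: le_trans (member_variance S_gt0 W_cdv unif range Ap Yb n0 Jj) _.
  rewrite /var_rate -EFinM lee_fin ler_wpM2r ?lerDl//.
Qed.
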